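(* Let $\mathcal{R}$ be an ergodic countable measured (non-singular) equivalence relation on a standard probability space $(X,\mu)$. Then the following are equivalent: (1) The probability measure $\mu$ is diffuse. (2) There exists a genuine discrete measured groupoid $\mathcal{G}$ with unit space $(X,\mu)$ and associated equivalence relation $\mathcal{R}$.
   Context: Discrete measured groupoids. A discrete Borel groupoid $\mathcal{G}$ is a groupoid with a standard Borel structure such that the unit space $\mathcal{G}^{(0)}$ is a Borel subset, the operations are Borel, and the source and target maps $s,t:\mathcal{G}\to\mathcal{G}^{(0)}$ are countable-to-one Borel maps. If $X=\mathcal{G}^{(0)}$ carries a Borel probability measure $\mu$, put $\mu_s(A)=\int_X \#(A\cap s^{-1}(x))\,d\mu(x)$ and $\mu_t(A)=\int_X \#(A\cap t^{-1}(x))\,d\mu(x)$ for Borel $A\subseteq\mathcal{G}$. $\mathcal{G}$ is a discrete measured groupoid with unit space $(X,\mu)$ if $\mu_s$ and $\mu_t$ have the same null sets. Two discrete measured groupoids are isomorphic if there is a nonsingular Borel isomorphism between them preserving multiplication and inverses. As usual in the measured setting, isomorphisms and identifications are understood up to null sets, i.e. after restricting to conull Borel subsets of the unit spaces. Equivalence relations. A countable measured equivalence relation $\mathcal{R}$ on a standard probability space $(X,\mu)$ is an equivalence relation that is a Borel subset of $X\times X$, has countable classes, and is non-singular: for every non-null Borel $E\subseteq X$, the saturation $\mathcal{R}(E)=\{y\in X : (y,x)\in\mathcal{R}\text{ for some }x\in E\}$ is non-null (equivalently, $\mu_s$ and $\mu_t$ are equivalent on $\mathcal{R}$). It is a discrete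 measured groupoid with unit space $(X,\mu)$, where $(x,y)$ has source $y$ and target $x$. $\mathcal{R}$ is ergodic if every $\mathcal{R}$-invariant Borel subset of $X$ is $\mu$-null or $\mu$-conull. The equivalence relation associated to a discrete measured groupoid $\mathcal{G}$ is $\mathcal{R}_{\mathcal{G}}=\{(t(g),s(g)) : g\in\mathcal{G}\}$, and $\mathcal{G}$ is ergodic if $\mathcal{R}_{\mathcal{G}}$ is. Transformation groupoids. For a nonsingular action $G\curvearrowright(X,\mu)$ of a countable discrete group on a standard probability space, the transformation groupoid is $X\rtimes G=\{(x,g): x\in X, g\in G\}$ with unit space $(X,\mu)$, $s(x,g)=x$, $t(x,g)=gx$, $(gx,h)(x,g)=(x,hg)$, $(x,g)^{-1}=(gx,g^{-1})$. Genuine. An ergodic discrete measured groupoid is called genuine if it is not isomorphic to a countable measured equivalence relation nor to a transformation groupoid. *)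

(* Defs.v *)
From HB Require Import structures.
From mathcomp Require Import all_boot all_order all_algebra.
From mathcomp Require Import all_classical all_reals all_analysis.

Set Implicit Arguments.
Unset Strict Implicit.
Unset Printing Implicit Defensive.

Import Order.TTheory GRing.Theory Num.Theory.

Local Open Scope classical_set_scope.
Local Open Scope ring_scope.

Definition polish (R : realType) (P : metricType R) : Prop :=
  (forall F : set_system P, ProperFilter F -> cauchy F -> exists p : P, F --> p) /\
  (exists2 D : set P, countable D & dense D).

(* The real field only serves as codomain of the metric. *)
Definition standard_borel (R : realType) d (X : measurableType d) : Prop :=
  exists (P : metricType R) (f : X -> P),
    [/\ polish P, bijective f &
        @measurable d X = preimage_set_system setT f (<<s @open P >>)].

Definition conull (R : realType) d (X : measurableType d)
    (mu : probability X R) (A : set X) : Prop :=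
  measurable A /\ mu (~` A) = 0%E.

Definition diffuse (R : realType) d (X : measurableType d)
    (mu : probability X R) : Prop :=
  forall x, mu [set x] = 0%E.

Definition invariant_set (X : Type) (E : set (X * X)) (A : set X) : Prop :=
  forall x y, E (x, y) -> (A x <-> A y).

Definition ergodic_rel (R : realType) d (X : measurableType d)
    (mu : probability X R) (E : set (X * X)) : Prop :=
  forall A : set X, measurable A -> invariant_set E A ->
    mu A = 0%E \/ mu (~` A) = 0%E.

(* Operations of a groupoid with unit space X.  The arrows are the elements of
   the set arr; the operations are total functions on the ambient type A, and
   only their values on arrows (on composable pairs of arrows for mul) are
   meaningful.  The unit space is embedded in the arrows by unit_of.  The
   product mul g h is the composite "first h, then g", defined when
   src g = tgt h. *)
Record groupoid_ops (X A : Type) := GroupoidOps {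
  arr : set A;
  src : A -> X;
  tgt : A -> X;
  unit_of : X -> A;
  mul : A -> A -> A;
  inv : A -> A }.

Definition composable (X A : Type) (G : groupoid_ops X A) : set (A * A) :=
  [set p | [/\ arr G p.1, arr G p.2 & src G p.1 = tgt G p.2]].

Record is_groupoid (X A : Type) (G : groupoid_ops X A) : Prop := IsGroupoid {
  arr_unit : forall x, arr G (unit_of G x);
  src_unit : forall x, src G (unit_of G x) = x;
  tgt_unit : forall x, tgt G (unit_of G x) = x;
  arr_mul : forall g h, composable G (g, h) -> arr G (mul G g h);
  src_mul : forall g h, composable G (g, h) -> src G (mul G g h) = src G h;
  tgt_mul : forall g h, composable G (g, h) -> tgt G (mul G g h) = tgt G g;
  mul_assoc : forall g h k, composable G (g, h) -> composable G (h, k) ->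
    mul G g (mul G h k) = mul G (mul G g h) k;
  mul_unitl : forall g, arr G g -> mul G (unit_of G (tgt G g)) g = g;
  mul_unitr : forall g, arr G g -> mul G g (unit_of G (src G g)) = g;
  arr_inv : forall g, arr G g -> arr G (inv G g);
  src_inv : forall g, arr G g -> src G (inv G g) = tgt G g;
  tgt_inv : forall g, arr G g -> tgt G (inv G g) = src G g;
  mul_invl : forall g, arr G g -> mul G (inv G g) g = unit_of G (src G g);
  mul_invr : forall g, arr G g -> mul G g (inv G g) = unit_of G (tgt G g) }.

(* The arrows form a Borel subset of a standard Borel space, hence are
   themselves standard Borel.  Measurability of unit_of and src makes X
   Borel isomorphic to the set of units, a Borel subset of the arrows. *)
Record discrete_borel_groupoid (R : realType) d d' (X : measurableType d)
    (A : measurableType d') (G : groupoid_ops X A) : Prop :=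
  DiscreteBorelGroupoid {
  dbg_groupoid : is_groupoid G;
  dbg_unit_space : standard_borel R X;
  dbg_ambient : standard_borel R A;
  dbg_arr : measurable (arr G);
  dbg_units : measurable (range (unit_of G));
  dbg_unit : measurable_fun setT (unit_of G);
  dbg_src : measurable_fun (arr G) (src G);
  dbg_tgt : measurable_fun (arr G) (tgt G);
  dbg_mul : measurable_fun (composable G) (fun p => mul G p.1 p.2);
  dbg_inv : measurable_fun (arr G) (inv G);
  dbg_src_countable : forall x, countable (arr G `&` src G @^-1` [set x]);
  dbg_tgt_countable : forall x, countable (arr G `&` tgt G @^-1` [set x]) }.

Definition mu_src (R : realType) d d' (X : measurableType d)
    (A : measurableType d') (mu : probability X R) (G : groupoid_ops X A)
    (B : set A) : \bar R :=
  (\int[mu]_x counting (B `&` src G @^-1` [set x]))%E.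

Definition mu_tgt (R : realType) d d' (X : measurableType d)
    (A : measurableType d') (mu : probability X R) (G : groupoid_ops X A)
    (B : set A) : \bar R :=
  (\int[mu]_x counting (B `&` tgt G @^-1` [set x]))%E.

Definition nonsingular (R : realType) d d' (X : measurableType d)
    (A : measurableType d') (mu : probability X R) (G : groupoid_ops X A) :
    Prop :=
  forall B : set A, measurable B -> B `<=` arr G ->
    (mu_src mu G B = 0%E <-> mu_tgt mu G B = 0%E).

Definition discrete_measured_groupoid (R : realType) d d'
    (X : measurableType d) (A : measurableType d') (mu : probability X R)
    (G : groupoid_ops X A) : Prop :=
  discrete_borel_groupoid R G /\ nonsingular mu G.

Definition assoc_rel (X A : Type) (G : groupoid_ops X A) : set (X * X) :=
  [set (tgt G g, src G g) | g in arr G].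

Definition ergodic_groupoid (R : realType) d d' (X : measurableType d)
    (A : measurableType d') (mu : probability X R) (G : groupoid_ops X A) :
    Prop :=
  ergodic_rel mu (assoc_rel G).

Definition restr_arr (X A : Type) (G : groupoid_ops X A) (X0 : set X) : set A :=
  arr G `&` src G @^-1` X0 `&` tgt G @^-1` X0.

(* Isomorphism up to null sets: a nonsingular Borel isomorphism between the
   restrictions of G and H to conull Borel subsets X0 and Y0 of their unit
   spaces. *)
Definition isomorphic (R : realType) dX dA dY dB
    (X : measurableType dX) (A : measurableType dA)
    (Y : measurableType dY) (B : measurableType dB)
    (mu : probability X R) (G : groupoid_ops X A)
    (nu : probability Y R) (H : groupoid_ops Y B) : Prop :=
  exists (X0 : set X) (Y0 : set Y) (f : A -> B),
  [/\ conull mu X0 /\ conull nu Y0,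
      set_bij (restr_arr G X0) (restr_arr H Y0) f,
      measurable_fun (restr_arr G X0) f /\
      (forall C, measurable C -> C `<=` restr_arr G X0 -> measurable (f @` C)),
      (forall g h, restr_arr G X0 g -> restr_arr G X0 h ->
         composable G (g, h) ->
         composable H (f g, f h) /\ f (mul G g h) = mul H (f g) (f h)) /\
      (forall g, restr_arr G X0 g -> f (inv G g) = inv H (f g)) &
      forall C, measurable C -> C `<=` restr_arr G X0 ->
        (mu_src mu G C = 0%E <-> mu_src nu H (f @` C) = 0%E)].

Definition rel_groupoid (X : Type) (E : set (X * X)) :
    groupoid_ops X (X * X) := {|
  arr := E;
  src := fun p => p.2;
  tgt := fun p => p.1;
  unit_of := fun x => (x, x);
  mul := fun p q => (p.1, q.2);
  inv := fun p => (p.2, p.1) |}.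

(* Non-singularity is the equivalence of the two measures induced on E by the
   source and target maps (equivalently, saturations of null sets are null).
   Asking only that saturations of non-null sets be non-null would be void,
   since E is reflexive. *)
Record countable_measured_eqrel (R : realType) d (X : measurableType d)
    (mu : probability X R) (E : set (X * X)) : Prop :=
  CountableMeasuredEqrel {
  eqrel_measurable : measurable E;
  eqrel_refl : forall x, E (x, x);
  eqrel_sym : forall x y, E (x, y) -> E (y, x);
  eqrel_trans : forall x y z, E (x, y) -> E (y, z) -> E (x, z);
  eqrel_countable : forall x, countable [set y | E (x, y)];
  eqrel_nonsingular : nonsingular mu (rel_groupoid E) }.

Section DiscreteGroup.
Variable Gamma : groupType.

Definition discrete_group : Type := Gamma.

HB.instance Definition _ := Choice.on discrete_group.
HB.instance Definition _ := isPointed.Build discrete_group (1%g : Gamma).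
HB.instance Definition _ := @isMeasurable.Build default_measure_display
  discrete_group (@discrete_measurable Gamma)
  (@discrete_measurable0 Gamma) (@discrete_measurableC Gamma)
  (@discrete_measurableU Gamma).

End DiscreteGroup.

Record nonsingular_action (R : realType) d (X : measurableType d)
    (mu : probability X R) (Gamma : groupType) (a : Gamma -> X -> X) : Prop :=
  NonsingularAction {
  action_one : forall x, a 1%g x = x;
  action_mul : forall g h x, a (g * h)%g x = a g (a h x);
  action_measurable : forall g, measurable_fun setT (a g);
  action_nonsingular : forall g (B : set X), measurable B ->
    (mu (a g @^-1` B) = 0%E <-> mu B = 0%E) }.

Definition transformation_groupoid (X : Type) (Gamma : groupType)
    (a : Gamma -> X -> X) : groupoid_ops X (X * discrete_group Gamma) := {|
  arr := setT;
  src := fun p => p.1;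
  tgt := fun p => a p.2 p.1;
  unit_of := fun x => (x, 1%g : Gamma);
  mul := fun p q => (q.1, ((p.2 : Gamma) * (q.2 : Gamma))%g);
  inv := fun p => (a p.2 p.1, ((p.2 : Gamma)^-1)%g) |}.

Definition isomorphic_to_eqrel (R : realType) d d' (X : measurableType d)
    (A : measurableType d') (mu : probability X R) (G : groupoid_ops X A) :
    Prop :=
  exists (dY : measure_display) (Y : measurableType dY)
    (nu : probability Y R) (S : set (Y * Y)),
    [/\ standard_borel R Y, countable_measured_eqrel nu S &
        isomorphic mu G nu (rel_groupoid S)].

Definition isomorphic_to_transformation (R : realType) d d'
    (X : measurableType d) (A : measurableType d') (mu : probability X R)
    (G : groupoid_ops X A) : Prop :=
  exists (dY : measure_display) (Y : measurableType dY)
    (nu : probability Y R) (Gamma : groupType) (a : Gamma -> Y -> Y),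
    [/\ standard_borel R Y, countable [set: Gamma], nonsingular_action nu a &
        isomorphic mu G nu (transformation_groupoid a)].

Definition genuine (R : realType) d d' (X : measurableType d)
    (A : measurableType d') (mu : probability X R) (G : groupoid_ops X A) :
    Prop :=
  [/\ discrete_measured_groupoid mu G, ergodic_groupoid mu G,
      ~ isomorphic_to_eqrel mu G & ~ isomorphic_to_transformation mu G].

Definition eq_rel_ae (R : realType) d (X : measurableType d)
    (mu : probability X R) (E F : set (X * X)) : Prop :=
  exists2 X0 : set X, conull mu X0 &
    forall x y, X0 x -> X0 y -> (E (x, y) <-> F (x, y)).

(* Main.v *)
Require Import Defs.
From HB Require Import structures.
From mathcomp Require Import finmap.
From mathcomp Require Import all_boot all_order all_algebra.
From mathcomp Require Import all_classical all_reals all_analysis.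

Set Implicit Arguments.
Unset Strict Implicit.
Unset Printing Implicit Defensive.

Import Order.TTheory GRing.Theory Num.Theory.

Local Open Scope classical_set_scope.
Local Open Scope ring_scope.


(** Suppose that mu has an atom x. By ergodicity the class of x is conull, and
removing its null points leaves a countable conull set S of atoms. Over S, a
groupoid with associated relation E is transitive, hence the product of S x S by
the isotropy group K of a point. Identify S with a countable group L of the same
cardinality: the groupoid becomes the transformation groupoid of K x L, where K
acts trivially and L by translations ([transitive_transformation]). So no
groupoid over E is genuine.

Suppose that mu is diffuse. Attach to every class C of E a countable group
Gamma_C, and let G be the groupoid of the triples (x, y, g) with (x, y) in E and
g in Gamma_C, where C is the class of x and y. Its isotropy groups are not
trivial, so G is not a relation. If G were a transformation groupoid of a
countable group Gamma, almost every isotropy group of G would embed in Gamma. It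
is thus enough that, for x in C, the point x can be read off from the
commutation relations between four elements of Gamma_C: the quadruples of Gamma
are countably many, but a conull set for a diffuse measure is uncountable
([twisted_not_transformation]).

Such groups are built from a Borel injection c of X into the sequences of bits.
Gamma_C is the semidirect product of Z[t] by the free product of groups of order
two with generators the letters (z, k), for z in C and k a natural number. The
letter (z, 0) multiplies t^i by -1 when the i-th bit of c z is set. The other
letters permute the monomials by one of two involutions of the exponents, which
are such that conjugating alternately by (x, 1) and (x, 2) leads from t^0 to
every t^n. As (x, 0) commutes with t^n exactly when the n-th bit of c x is not
set, the elements t^0, (x, 0), (x, 1) and (x, 2) determine x. Elements of the
free product are words without equal neighbours. Hence the arrows form a Borel
subset of a standard Borel space of lists, and no enumeration of the classes of
E enters.

There remains the nonsingularity of G. A Borel set B of arrows has a source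
image s(B) which is only analytic, and mu_src B = 0 says that s(B) contains no
Borel set of positive measure ([integral_counting_eq0]). By the measurable
projection theorem ([suslin_inner_null]), s(B) is then contained in a null Borel
set N. The nonsingularity of E makes the saturation of N null, and this
saturation contains t(B) ([assoc_rel_nonsingular]). *)

(** * Metric spaces *)

Lemma exists_invS_lt (R : realType) (e : R) : 0 < e -> exists k, k.+1%:R^-1 < e.
Proof.
move=> e0; exists (Num.truncn e^-1).
rewrite -[ltRHS]invrK ltf_pV2 ?posrE ?invr_gt0 ?ltr0n//.
by rewrite -truncn_lt_nat// invr_ge0 ltW.
Qed.

Lemma open_mball (R : realType) (P : metricType R) (p : P) e : open (ball p e).
Proof.
rewrite openE => q; rewrite ballEmdist /= => pq; apply/nbhs_ballP.
exists (e - mdist p q); first by rewrite /= subr_gt0.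
move=> r; rewrite !ballEmdist /= ltrBrDl; apply: le_lt_trans.
exact: metric_triangle.
Qed.

Lemma closed_mball (R : realType) (P : metricType R) (p : P) e :
  closed [set q | mdist p q <= e].
Proof.
rewrite -[X in closed X]setCK; apply: open_closedC; rewrite openE => q /= /negP.
rewrite -ltNge => pq; apply/nbhs_ballP; exists (mdist p q - e); first by rewrite /= subr_gt0.
move=> r; rewrite ballEmdist /= ltrBrDr => qr; apply/negP; rewrite -ltNge.
rewrite -(ltrD2l (mdist q r)) (lt_le_trans qr)// (le_trans (metric_triangle p r q))//.
by rewrite (metric_sym r) addrC.
Qed.

Lemma polish_dense_seq (R : realType) (P : metricType R) : P -> polish P ->
  exists D : nat -> P, forall e p, 0 < e -> exists n, mdist (D n) p < e.
Proof.
move=> p0 [_ [D0 cD0 dD0]].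
have [g ginj] := countable_injP _ cD0.
have /choice[D HD] n : exists p, forall q, D0 q -> g q = n -> p = q.
  have [[q [D0q qn]]|nq] := pselect (exists q, D0 q /\ g q = n).
    by exists q => r D0r rn; apply: ginj; rewrite ?inE// qn rn.
  by exists p0 => r D0r rn; exfalso; apply: nq; exists r.
exists D => e p e0.
have [|q [pq D0q]] := dD0 (ball p e)^° _ (open_interior _).
  by exists p; apply/nbhs_ballP; exists e.
exists (g q); rewrite (HD _ q)//; have := interior_subset pq.
by rewrite ballEmdist /= metric_sym.
Qed.

(** * Suslin schemes and measurable projection *)

Section Suslin.
Context (R : realType) d (X : measurableType d) (P : metricType R).
Variables (A : Type) (f : A -> P).

Definition agree n (a b : nat -> nat) := forall i, (i < n)%N -> a i = b i.

Lemma agree_sym n a b : agree n a b -> agree n b a.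
Proof. by move=> ab i /ab. Qed.

(** A Suslin scheme for subsets of X x A. A branch [a] selects countably many
conditions, each of them a rectangle with closed second side. A condition looks
at finitely many values of the branch, but how many may depend on the branch. *)
Definition suslin (H : set (X * A)) :=
  exists (M : nat -> (nat -> nat) -> set X) (C : nat -> (nat -> nat) -> set P),
  [/\ forall n a, measurable (M n a),
      forall n a, closed (C n a),
      forall n a, exists k, forall b, agree k a b -> M n b = M n a /\ C n b = C n a &
      forall x y, H (x, y) <-> exists a, forall n, M n a x /\ C n a (f y)].

Lemma suslin_rect (M : set X) (C : set P) : measurable M -> closed C ->
  suslin [set p | M p.1 /\ C (f p.2)].
Proof.
move=> mM cC; exists (fun _ _ => M), (fun _ _ => C); split=> //.
  by move=> n a; exists 0%N.
by move=> x y; split=> [H|[a Ha]]; [exists id|exact: (Ha 0%N)].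
Qed.

(** The first value of the branch tells which set of the union is meant; the
others form a branch for that set. *)
Lemma suslin_bigcup (F : nat -> set (X * A)) :
  (forall i, suslin (F i)) -> suslin (\bigcup_i F i).
Proof.
move=> /choice[M] /choice[C] sF.
exists (fun n a => M (a 0%N) n (a \o succn)), (fun n a => C (a 0%N) n (a \o succn)).
split.
- by move=> n a; have [+ _ _ _] := sF (a 0%N); apply.
- by move=> n a; have [_ + _ _] := sF (a 0%N); apply.
- move=> n a; have [_ _ /(_ n (a \o succn))[k ak] _] := sF (a 0%N).
  exists k.+1 => b ab; rewrite -(ab 0%N)//; apply: ak => i ik /=.
  exact: ab.
- move=> x y; split=> [[i _ Fi]|[a Ha]].
    have [_ _ _ /(_ x y)[+ _]] := sF i => /(_ Fi)[a Ha].
    by exists (fun n => if n is m.+1 then a m else i).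
  exists (a 0%N) => //; have [_ _ _ /(_ x y)[_]] := sF (a 0%N); apply.
  by exists (a \o succn).
Qed.

(** One branch encodes a branch for each of the sets, by pairing indices. *)
Lemma suslin_bigcap (F : nat -> set (X * A)) :
  (forall i, suslin (F i)) -> suslin (\bigcap_i F i).
Proof.
move=> /choice[M] /choice[C] sF.
pose part (i : nat) (a : nat -> nat) (n : nat) := a (pickle (i, n)).
pose M' m a := if unpickle m is Some (i, n) then M i n (part i a) else setT.
pose C' m a := if unpickle m is Some (i, n) then C i n (part i a) else setT.
exists M', C'; split.
- move=> m a; rewrite /M'; case: unpickle => [[i n]|//].
  by have [+ _ _ _] := sF i; apply.
- move=> m a; rewrite /C'; case: unpickle => [[i n]|]; last exact: closedT.
  by have [_ + _ _] := sF i; apply.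
- move=> m a; rewrite /M' /C'; case: unpickle => [[i n]|]; last by exists 0%N.
  have [_ _ /(_ n (part i a))[k ak] _] := sF i.
  exists (\max_(j < k) pickle (i, nat_of_ord j)).+1 => b ab; apply: ak => j jk.
  by apply: ab; rewrite ltnS (leq_bigmax (Ordinal jk)).
- move=> x y; split=> [FI|[a Ha] i _].
    have /choice[a Ha] i : exists a, forall n, M i n a x /\ C i n a (f y).
      by have [_ _ _ /(_ x y)[+ _]] := sF i; apply; exact: FI.
    exists (fun m => if unpickle m is Some (i, n) then a i n else 0%N) => m.
    rewrite /M' /C'; case: unpickle => [[i n]|//].
    rewrite (_ : part i _ = a i)//.
    by apply/funext => j; rewrite /part /= pickleK.
  have [_ _ _ /(_ x y)[_]] := sF i; apply; exists (part i a) => n.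
  by have := Ha (pickle (i, n)); rewrite /M' /C' pickleK.
Qed.

(** An open set is the union over n of the closed sets of the points at distance
at least 1/(n+1) from its complement. *)
Lemma suslin_open (U : set P) : open U -> suslin [set p | U (f p.2)].
Proof.
move=> oU; pose C n := [set p | forall q, ~ U q -> n.+1%:R^-1 <= mdist p q].
have cC n : closed (C n).
  rewrite -[C n]setCK; apply: open_closedC; rewrite openE => p /=.
  move=> /existsNP[q /not_implyP[Uq /negP]]; rewrite -ltNge => pq.
  apply/nbhs_ballP; exists (n.+1%:R^-1 - mdist p q); first by rewrite /= subr_gt0.
  move=> r; rewrite ballEmdist /= ltrBrDr => pr /(_ q Uq); apply/negP.
  rewrite -ltNge (le_lt_trans _ pr)// (le_trans (metric_triangle _ p _))//.
  by rewrite metric_sym.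
rewrite (_ : [set p | _] = \bigcup_n [set p | setT p.1 /\ C n (f p.2)]).
  by apply: suslin_bigcup => n; exact: suslin_rect.
apply/seteqP; split=> [[x y] /= Uy|[x y] /= [n _ [_ Cn]]]; last first.
  apply: contrapT => Uy; have := Cn _ Uy; rewrite mdistxx leNgt invr_gt0.
  by rewrite ltr0n.
have /nbhs_ballP[e /= e0 eU] := open_nbhs_nbhs (conj oU Uy).
have [k ke] := exists_invS_lt e0.
exists k => //; split=> // q Uq; rewrite leNgt; apply/negP => yq.
by apply: Uq; apply: eU; rewrite ballEmdist /=; exact: lt_trans yq ke.
Qed.

End Suslin.

(** Suslin sets are not stable under complement, but the sets which are Suslin
together with their complement form a sigma-algebra. *)
Lemma measurable_suslin (R : realType) d d' (X : measurableType d)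
    (A : measurableType d') (P : metricType R) (f : A -> P) :
  measurable = preimage_set_system setT f (<<s @open P >>) ->
  forall H : set (X * A), measurable H -> suslin f H.
Proof.
move=> mA H mH; pose good (H : set (X * A)) := suslin f H /\ suslin f (~` H).
have good_bigcup (F : nat -> set (X * A)) :
    (forall i, good (F i)) -> good (\bigcup_i F i).
  move=> gF; split; first by apply: suslin_bigcup => i; exact: (gF i).1.
  by rewrite setC_bigcup; apply: suslin_bigcap => i; exact: (gF i).2.
have goodC (B : set (X * A)) : good B -> good (~` B) by move=> [? ?]; split; rewrite ?setCK.
have goodX (M : set X) : measurable M -> good [set p | M p.1].
  have sX (N : set X) : measurable N -> suslin f [set p | N p.1].
    move=> mN; have := suslin_rect (A := A) f mN closedT.
    by congr suslin; apply/seteqP; split=> [p []|].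
  by move=> mM; split; [exact: sX|exact: sX (measurableC mM)].
have goodA (B : set A) : measurable B -> good [set p | B p.2].
  rewrite mA => -[W sW <-]; move: W sW.
  apply: smallest_sub => [|U oU]; first split.
  - by have := goodX set0 measurable0; congr good; apply/seteqP; split=> p //= [].
  - move=> W; rewrite setTD !setTI; exact: goodC.
  - move=> F gF; have := good_bigcup _ gF; congr good; apply/seteqP; split.
      by move=> p [i _ [_ Fi]]; split=> //; exists i.
    by move=> p [_ [i _ Fi]]; exists i.
  - rewrite setTI; split; first exact: suslin_open.
    have := suslin_rect (A := A) f (@measurableT _ X) (open_closedC oU).
    by congr suslin; apply/seteqP; split=> [p []|].
suff : good H by case.
move: H mH; apply: smallest_sub; first split.
- by have := goodX set0 measurable0; congr good; apply/seteqP; split=> p.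
- by move=> B; rewrite setTD; exact: goodC.
- exact: good_bigcup.
- by move=> _ [] [B mB <-]; rewrite setTI; [exact: goodX|exact: goodA].
Qed.

(** The pigeonhole principle along an ultrafilter, which provides the limit of a
sequence of branches below a fixed bound. *)
Lemma ultra_bounded (F : set_system nat) (g : nat -> nat) b :
  UltraFilter F -> F [set k | (g k <= b)%N] -> exists v, F [set k | g k = v].
Proof.
move=> FU; elim: b => [|b IH] Fb.
  by exists 0%N; apply: filterS Fb => k /=; rewrite leqn0 => /eqP.
have [Fv|Fv] := in_ultra_setVsetC [set k | g k = b.+1] FU; first by exists b.+1.
apply: IH; apply: filterS2 Fb Fv => k /=.
by rewrite leq_eqVlt => /orP[/eqP//|].
Qed.

Section Projection.
Context (R : realType) d d' (X : measurableType d) (A : measurableType d').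
Context (P : metricType R) (f : A -> P).

(** Compactness will be applied to schemes with two more properties. The number
of values seen by a condition is bounded in terms of its index: condition n is
imposed at the index (n, k) if the first 2k+2 values of the branch decide it,
and void there otherwise. The closed sets shrink along every branch: the odd values of
the branch name points of D, and the point is required to be close to them. *)
Lemma suslin_normal (D : nat -> P) (H : set (X * A)) :
  (forall e p, 0 < e -> exists n, mdist (D n) p < e) -> suslin f H ->
  exists (M : nat -> (nat -> nat) -> set X) (C : nat -> (nat -> nat) -> set P)
    (K : nat -> nat),
  [/\ forall n a, measurable (M n a),
      forall n a, closed (C n a),
      forall n a b, agree (K n) a b -> M n b = M n a /\ C n b = C n a,
      forall e a, 0 < e -> exists n c, C n a `<=` ball c e &
      forall x y, H (x, y) <-> exists a, forall n, M n a x /\ C n a (f y)].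
Proof.
move=> denseD [M [C [mM cC locMC HMC]]].
pose evens (a : nat -> nat) n := a n.*2.
pose odds (a : nat -> nat) n := a n.*2.+1.
pose loc (n k : nat) a := forall b, agree k.*2.+2 a b ->
  M n (evens b) = M n (evens a) /\ C n (evens b) = C n (evens a).
have locE n k a b : agree k.*2.+2 a b -> loc n k a -> loc n k b.
  move=> ab la c bc; have [-> ->] : _ /\ _ := la c (fun i ik => etrans (ab i ik) (bc i ik)).
  by have [-> ->] := la b ab.
(* The values that decide condition n also tell that they decide it. *)
have locb n k a b : agree k.*2.+2 a b -> `[< loc n k a >] = `[< loc n k b >].
  by move=> ab; apply/asbool_equiv_eq; split; apply: locE => //; exact: agree_sym.
pose M' m a := if unpickle m is Some (n, k) then
  (if `[< loc n k a >] then M n (evens a) else setT) else setT.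
pose C' m a := if unpickle m is Some (n, k) then
  (if `[< loc n k a >] then C n (evens a) else setT) `&`
    [set p | mdist (D (odds a k)) p <= k.+1%:R^-1] else setT.
have locex n a : exists k, loc n k a.
  have [k ak] := locMC n (evens a); exists k => b ab; apply: ak => i ik.
  by apply: ab; rewrite -doubleS ltn_double ltnS ltnW.
exists M', C', (fun m => if unpickle m : option (nat * nat) is Some (n, k)
  then k.*2.+2 else 0%N).
split.
- by move=> m a; rewrite /M'; case: unpickle => [[n k]|//]; case: ifP.
- move=> m a; rewrite /C'; case: unpickle => [[n k]|]; last exact: closedT.
  by apply: closedI; [case: ifP => // _; exact: closedT|exact: closed_mball].
- move=> m a b; rewrite /M' /C'; case: unpickle => [[n k]|//] ab.
  rewrite -(locb n k a b ab) (_ : odds b k = odds a k); last by rewrite /odds ab.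
  by case: asboolP => // la; have [-> ->] := la _ ab.
- move=> e a e0; have [k ke] := exists_invS_lt e0.
  exists (pickle (0%N, k)), (D (odds a k)).
  by rewrite /C' pickleK => p [_] /=; rewrite ballEmdist /= => /le_lt_trans; apply.
- move=> x y; rewrite HMC; split=> -[a Ha].
    have /choice[c Hc] k : exists n, mdist (D n) (f y) <= k.+1%:R^-1.
      have [n nk] := denseD k.+1%:R^-1 (f y) ltac:(by rewrite invr_gt0 ltr0n).
      by exists n; exact: ltW.
    pose b i := if odd i then c i./2 else a i./2.
    have evb : evens b = a.
      by apply/funext => i; rewrite /evens /b odd_double doubleK.
    exists b => m; rewrite /M' /C'; case: unpickle => [[n k]|//].
    rewrite evb; have [? ?] := Ha n; split; first by case: ifP.
    split; first by case: ifP.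
    by rewrite /= /odds /b /= odd_double /= uphalf_double; exact: Hc.
  exists (evens a) => n; have [k nk] := locex n a; have := Ha (pickle (n, k)).
  by rewrite /M' /C' pickleK asboolT// => -[? []].
Qed.

Hypotheses (polP : polish P) (surjf : forall p, exists a, f a = p).

(** Measurable projection: a projection of inner measure 0 has outer measure 0.
Suppose that the outer measure is larger than some r > 0. As outer measure is
continuous along increasing unions, bounds [beta] can be imposed on the values
of the branches one after the other, and the outer measure remains above r. Let
L k be the set of the points that satisfy the first k conditions along a branch
below beta. It is measurable of measure at least r, and so is the intersection
of the L k. The branches below beta form a compact space and the closed sets
shrink, so that this intersection is contained in the projection. *)
Lemma suslin_inner_null (mu : {measure set X -> \bar R}) (H : set (X * A)) :
  (mu setT < +oo)%E -> suslin f H ->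
  (forall M, measurable M -> (forall x, M x -> exists y, H (x, y)) ->
    mu M = 0%E) ->
  exists N, [/\ measurable N, mu N = 0%E & forall x y, H (x, y) -> N x].
Proof.
move=> muT sH inner; have [D denseD] := polish_dense_seq (f point) polP.
have [M [C [K [mM cC locMC tbC HMC]]]] := suslin_normal denseD sH.
(* [small r S]: S has outer measure at most r. *)
pose small r (S : set X) := exists N, [/\ measurable N, S `<=` N & (mu N <= r)%E].
pose sol a x := exists y, forall n, M n a x /\ C n a (f y).
pose S b x := exists2 a, forall i, (i < size b)%N -> (a i <= nth 0%N b i)%N & sol a x.
have [|nsmall] := pselect (forall n, small n.+1%:R^-1%:E (S [::])).
  move=> /choice[N HN]; exists (\bigcap_n N n); split.
  - by apply: bigcapT_measurable => n; have [] := HN n.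
  - apply/eqP; rewrite eq_le measure_ge0 andbT; apply/lee_addgt0Pr => e e0.
    rewrite add0e; have [k ke] := exists_invS_lt e0; have [mNk _ Nk] := HN k.
    apply: (@le_trans _ _ (mu (N k))).
      apply: le_measure; rewrite ?inE//; last exact: bigcap_inf.
      by apply: bigcapT_measurable => n; have [] := HN n.
    by apply: (le_trans Nk); rewrite lee_fin ltW.
  - move=> x y /HMC[a Ha] n _; have [_ + _] := HN n; apply.
    by exists a => //; exists y.
exfalso; have /existsNP[n0 {}nsmall] := nsmall.
set r := n0.+1%:R^-1%:E in nsmall.
(* Outer measure is continuous along increasing unions: if each set has a hull of
   measure at most r, so does the union, namely the lower limit of the hulls. *)
have step b : ~ small r (S b) -> exists v, ~ small r (S (rcons b v)).
  move=> nb; apply: contrapT => /forallNP nv; apply: nb.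
  have {}nv v : small r (S (rcons b v)) by exact: contrapT.
  have [N HN] := choice nv.
  pose T n := \bigcap_(m in [set m | (n <= m)%N]) N m.
  have mT n : measurable (T n).
    by apply: bigcap_measurableType => k _; have [] := HN k.
  have Tmono : nondecreasing_seq T.
    by move=> m n mn; apply/subsetPset => x Tx k /= nk; apply: Tx; exact: leq_trans nk.
  exists (\bigcup_n T n); split; first exact: bigcupT_measurable.
    move=> x [a ab solx]; exists (a (size b)) => // m /= am.
    have [_ + _] := HN m; apply; exists a => // i; rewrite size_rcons ltnS nth_rcons.
    by rewrite leq_eqVlt => /orP[/eqP->|ib]; [rewrite ltnn eqxx|rewrite ib ab].
  have cvgT := nondecreasing_cvg_mu (mu := mu) mT (bigcupT_measurable _ mT) Tmono.
  rewrite -(cvg_lim _ cvgT)//; apply: lime_le; first by apply/cvg_ex; eexists; exact: cvgT.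
  apply: nearW => n; have [mN _ Nr] := HN n; apply: le_trans Nr.
  by apply: le_measure; rewrite ?inE// => x; apply => /=.
have {}/choice[v Hv] b : exists v, ~ small r (S b) -> ~ small r (S (rcons b v)).
  have [sb|/step[v Hv]] := pselect (small r (S b)); first by exists 0%N.
  by exists v.
pose b n := iter n (fun b => rcons b (v b)) [::].
have sizeb n : size (b n) = n by elim: n => //= n; rewrite size_rcons => ->.
pose beta n := v (b n).
have nthb n i : (i < n)%N -> nth 0%N (b n) i = beta i.
  elim: n => // n IH; rewrite ltnS leq_eqVlt /= nth_rcons sizeb => /orP[/eqP->|il].
    by rewrite ltnn eqxx.
  by rewrite il IH.
have nsb n : ~ small r (S (b n)) by elim: n => //= n; exact: Hv.
pose approx k a x := exists2 y, forall i, (a i <= beta i)%N &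
  forall m, (m < k)%N -> M m a x /\ C m a (f y).
pose L k : set X := [set x | exists a, approx k a x].
pose len k := \max_(m < k) K m.
have lenP k m : (m < k)%N -> (K m <= len k)%N.
  by move=> mk; rewrite (leq_bigmax (Ordinal mk)).
(* The first k conditions see only [len k] values, so that a branch may be
   truncated to a finite list, continued by 0. *)
have LE k a x y : (forall i, (i < len k)%N -> (a i <= beta i)%N) ->
    (forall m, (m < k)%N -> M m a x /\ C m a (f y)) ->
    approx k (nth 0%N (mkseq a (len k))) x.
  move=> ab Ha; exists y => [i|m mk].
    have [il|li] := ltnP i (len k); first by rewrite nth_mkseq// ab.
    by rewrite nth_default// size_mkseq.
  have ac : agree (K m) a (nth 0%N (mkseq a (len k))).
    by move=> i im; rewrite nth_mkseq//; apply: leq_trans (lenP _ _ mk).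
  by have [-> ->] := locMC _ _ _ ac; exact: Ha.
have mL k : measurable (L k).
  rewrite (_ : L k = \bigcup_(s : seq nat) [set x | approx k (nth 0%N s) x]).
    apply: countable_bigcupT_measurable => // s.
    have [[y [yb Cy]]|ny] := pselect (exists y, (forall i, (nth 0%N s i <= beta i)%N) /\
        forall m, (m < k)%N -> C m (nth 0%N s) (f y)).
      rewrite (_ : [set x | _] = \bigcap_(m in [set m | (m < k)%N]) M m (nth 0%N s)).
        exact: bigcap_measurableType.
      apply/seteqP; split=> [x [z _ Hz] m /Hz[]//|x Hx].
      by exists y => // m mk; split; [exact: Hx|exact: Cy].
    rewrite (_ : [set x | _] = set0)//; apply/seteqP; split=> // x [y yb Hy].
    by apply: ny; exists y; split=> // m /Hy[].
  apply/seteqP; split=> [x [a [y ab Ha]]|x [s _ sx]]; last by exists (nth 0%N s).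
  by exists (mkseq a (len k)) => //; exact: (LE _ _ _ y).
have rL k : (r <= mu (L k))%E.
  rewrite leNgt; apply/negP => /ltW Lr; apply: (nsb (len k)); exists (L k); split=> //.
  move=> x [a ab [y Ha]]; exists (nth 0%N (mkseq a (len k))); apply: (LE _ _ _ y) => //.
  by move=> i il; rewrite -(nthb (len k))// ab// sizeb.
have Lmono : nonincreasing_seq L.
  move=> m n mn; apply/subsetPset => x [a [y ab Ha]]; exists a, y => // k km.
  by apply: Ha; exact: leq_trans mn.
have mLI : measurable (\bigcap_k L k) by exact: bigcapT_measurable.
have muLI0 : mu (\bigcap_k L k) = 0%E.
  apply: inner => // x LIx.
  have /choice[z Hz] k : exists z : (nat -> nat) * A,
      (forall i, (z.1 i <= beta i)%N) /\
      forall m, (m < k)%N -> M m z.1 x /\ C m z.1 (f z.2).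
    by have [a [y ab Ha]] := LIx k Logic.I; exists (a, y).
  (* The branches and points of the stages k converge along an ultrafilter. *)
  have [F [FU Foo]] := ultraFilterLemma eventually_filter.
  have /choice[a Ha] i : exists v, F [set k | (z k).1 i = v].
    by apply: (@ultra_bounded _ _ (beta i)); apply: filterS filterT => k _; exact: (Hz k).1.
  have Fagree n : F [set k | agree n a (z k).1].
    elim: n => [|n IH]; first by apply: filterS filterT => k _ i.
    apply: filterS2 IH (Ha n) => k /= an kn i; rewrite ltnS leq_eqVlt.
    by move=> /orP[/eqP->|/an].
  have FC m : F [set k | M m a x /\ C m a (f (z k).2)].
    apply: filterS2 (Fagree (K m)) (Foo _ (nbhs_infty_gt m)) => k /= ak mk.
    by have [<- <-] := locMC _ _ _ ak; exact: (Hz k).2.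
  pose G := (f \o snd \o z) @ F.
  have [p Gp] : exists p : P, G --> p.
    have PG : ProperFilter G by exact: fmap_proper_filter.
    apply: (polP.1 _ PG); apply: cauchy_exP => e e0; have [n [c Cc]] := tbC e a e0.
    exists c; suff : F [set k | ball c e (f (z k).2)] by [].
    by apply: filterS (FC n) => k /= [_ Ck]; exact: Cc.
  have [y yp] := surjf p; exists y; apply/HMC; exists a => m; split.
    by have /filter_ex[k []] := FC m.
  rewrite yp; apply: cC => B Bp; have FB : F [set k | B (f (z k).2)] by exact: Gp.
  have /filter_ex[k [/= Bk [_ Ck]]] : F ([set k | B (f (z k).2)] `&`
    [set k | M m a x /\ C m a (f (z k).2)]) by exact: filterI.
  by exists (f (z k).2).
suff : (0 < mu (\bigcap_k L k))%E by rewrite muLI0 ltxx.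
apply: (@lt_le_trans _ _ r); first by rewrite lte_fin invr_gt0 ltr0n.
have cvgL : mu (L k) @[k --> \oo] --> mu (\bigcap_k L k).
  apply: nonincreasing_cvg_mu => //.
  by rewrite (le_lt_trans _ muT)// le_measure ?inE.
rewrite -(cvg_lim _ cvgL)//; apply: lime_ge; first by apply/cvg_ex; eexists; exact: cvgL.
by apply: nearW => n; exact: rL.
Qed.

End Projection.

(** * Standard Borel spaces and nonsingularity *)

(** The sets are balls around a dense sequence: two points in a ball of radius
1/(k+1) are close, which is why one implication is enough. *)
Lemma standard_borel_separated (R : realType) d (X : measurableType d) :
  standard_borel R X -> exists U : nat -> set X,
    (forall n, measurable (U n)) /\
    forall x y, (forall n, U n x -> U n y) -> x = y.
Proof.
move=> [P [f [polP [g fK gK] mX]]].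
have [D denseD] := polish_dense_seq (f point) polP.
exists (fun m => if unpickle m is Some (n, k)
  then f @^-1` ball (D n) k.+1%:R^-1 else setT); split=> [m|x y xy].
  case: unpickle => [[n k]|]; last exact: measurableT.
  rewrite mX; exists (ball (D n) k.+1%:R^-1); last by rewrite setTI.
  by apply: sub_sigma_algebra; exact: open_mball.
rewrite -(fK x) -(fK y); congr g; apply: mdist_positivity; apply/eqP.
rewrite eq_le mdist_ge0 andbT; apply/ler_addgt0Pl => e e0; rewrite addr0.
have [k /ltW ke] : exists k, k.+1%:R^-1 < e / 2 by apply: exists_invS_lt; rewrite divr_gt0.
have [n Dx] := denseD k.+1%:R^-1 (f x) ltac:(by rewrite invr_gt0 ltr0n).
have := xy (pickle (n, k)); rewrite pickleK /= !ballEmdist /= => /(_ Dx) Dy.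
rewrite (le_trans (metric_triangle _ (D n) _))// [leRHS]splitr metric_sym.
by rewrite lerD// (le_trans _ ke)// ltW.
Qed.

(** Where f and g differ, some set of a separating sequence contains the value of
one but not of the other. *)
Lemma measurable_coincidence (R : realType) d d' (X : measurableType d)
    (T : measurableType d') (D : set T) (f g : T -> X) :
  standard_borel R X -> measurable D ->
  measurable_fun D f -> measurable_fun D g -> measurable (D `&` [set t | f t = g t]).
Proof.
move=> /standard_borel_separated[U [mU Usep]] mD mf mg.
rewrite (_ : D `&` _ = \bigcap_n ((D `&` f @^-1` (~` U n)) `|` (D `&` g @^-1` U n))).
  apply: bigcapT_measurable => n; apply: measurableU; [apply: mf|exact: mg] => //.
  exact: measurableC.
apply/seteqP; split=> [t [Dt /= fg] n _ /=|t Ut].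
  by have [Un|Un] := pselect (U n (g t)); [right|left; split; rewrite //= fg].
split=> /=; first by have [[]|[]] := Ut 0%N Logic.I.
by apply: Usep => n Un; have [[]|[]] := Ut n Logic.I.
Qed.

Lemma standard_borel_set1 (R : realType) d (X : measurableType d) (x : X) :
  standard_borel R X -> measurable [set x].
Proof.
move=> sX; rewrite (_ : [set x] = setT `&` [set t | id t = cst x t]).
  exact: (measurable_coincidence sX measurableT (@measurable_id _ _ _) (measurable_cst _)).
by rewrite setTI.
Qed.

Lemma standard_borel_countable (R : realType) d (X : measurableType d) (C : set X) :
  standard_borel R X -> countable C -> measurable C.
Proof. by move=> sX; apply: countable_measurable => x; exact: standard_borel_set1 sX. Qed.

Section Counting.
Context (R : realType) d (X : measurableType d) (mu : {measure set X -> \bar R}).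

Import HBNNSimple.

(** The counting function may fail to be measurable. Its integral is the supremum
of the integrals of the simple functions below it, and so it vanishes when the
set where the function is positive has inner measure 0. *)
Lemma integral_counting_eq0 (A : choiceType) (S : X -> set A) :
  (\int[mu]_x counting (S x) = 0)%E <->
  forall M, measurable M -> (forall x, M x -> S x !=set0) -> mu M = 0%E.
Proof.
have c0 x : (0 <= counting (S x) :> \bar R)%E.
  by rewrite /counting; case: ifPn => _; rewrite ?lee_fin// leey.
have c1 x : S x !=set0 -> (1 <= counting (S x) :> \bar R)%E.
  move=> [a Sa]; rewrite /counting; case: ifPn => [/asboolP fS|_]; last exact: leey.
  rewrite lee_fin (_ : 1 = 1%:R)// ler_nat lt0n cardfs_eq0.
  by apply/fset0Pn; exists a; rewrite in_fset_set// inE.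
rewrite ge0_integralTE//; split=> [I0 M mM MS|null].
  apply/eqP; rewrite eq_le measure_ge0 andbT -[leRHS]I0.
  apply: ereal_sup_ubound; exists (indic_nnsfun R mM); last exact: sintegral_indic.
  move=> x; rewrite [X in (X%:E <= _)%E](_ : _ = \1_M x)// indicE.
  case: (boolP (x \in M)) => [|_]; last exact: c0.
  by rewrite inE => /MS; exact: c1.
apply/eqP; rewrite eq_le; apply/andP; split; last first.
  by apply: ereal_sup_ubound; exists nnsfun0; [|exact: sintegral0].
apply/ge_ereal_sup => _ [h hS <-]; rewrite /sintegral fsbig1// => x _.
have [->|x0] := eqVneq x 0; first by rewrite mul0e.
rewrite null ?mule0// => y /= hy.
apply/set0P/eqP => Sy; have := hS y; rewrite /= hy Sy /counting asboolT//.
rewrite fset_set0 lee_fin => x_le0; move/eqP: x0; apply.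
by apply/eqP; rewrite eq_le x_le0 -hy fun_ge0.
Qed.

End Counting.

Section Nonsingular.
Context (R : realType) d (X : measurableType d) (mu : probability X R).

(** The image is the projection of the graph of s, which is measurable. *)
Lemma image_inner_null d' (A : measurableType d') (D : set A) (s : A -> X) :
  standard_borel R X -> standard_borel R A -> measurable D -> measurable_fun D s ->
  (forall M, measurable M -> M `<=` s @` D -> mu M = 0%E) ->
  exists N, [/\ measurable N, mu N = 0%E & s @` D `<=` N].
Proof.
move=> sX [P [f [polP [g fK gK] mA]]] mD ms inner.
have mDx : measurable (setT `*` D : set (X * A)) by exact: measurableX.
have mH : measurable ((setT `*` D) `&` [set p : X * A | s p.2 = p.1]).
  apply: (measurable_coincidence sX mDx) => [_ Y mY|]; last first.
    exact: measurable_funTS measurable_fst.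
  rewrite (_ : _ `&` _ = setT `*` (D `&` s @^-1` Y)); last first.
    by apply/seteqP; split=> [p [[_ Dp] Yp]|p [_ [Dp Yp]]].
  by apply: measurableX => //; exact: ms.
have [|||N [mN N0 DN]] := suslin_inner_null (mu := mu) polP _ _ (measurable_suslin mA mH).
- by move=> p; exists (g p).
- exact: le_lt_trans (probability_le1 mu measurableT) (ltry _).
- move=> M mM MH; apply: inner => // x /MH[a [[_ Da] sa]]; exists a => //.
- by exists N; split=> // x [a Da <-]; exact: (DN _ a).
Qed.

(** Every groupoid over E inherits nonsingularity, whatever its isotropy. If B is
null for the sources, s(B) lies in a null Borel set N by [image_inner_null], and
t(B) lies in the saturation of N, to which the nonsingularity of E applies. *)
Lemma assoc_rel_nonsingular d' (A : measurableType d') (G : groupoid_ops X A)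
    (E : set (X * X)) :
  standard_borel R X -> standard_borel R A -> measurable (arr G) ->
  measurable_fun (arr G) (src G) -> measurable_fun (arr G) (tgt G) ->
  countable_measured_eqrel mu E -> assoc_rel G `<=` E -> nonsingular mu G.
Proof.
move=> sX sA mG msrc mtgt hE GE.
have sat N : measurable N -> mu N = 0%E -> 
    forall M, measurable M -> (forall x, M x -> exists2 y, N y & E (x, y)) -> mu M = 0%E.
  move=> mN N0 M mM MN; pose B := E `&` [set p | N p.2].
  have mB : measurable B.
    apply: measurableI; first exact: eqrel_measurable hE.
    by have := measurable_snd (T1 := X) (T2 := X) measurableT _ mN; rewrite setTI.
  have [srctgt _] := eqrel_nonsingular hE mB (@subIsetl _ _ _).
  have /srctgt : mu_src mu (rel_groupoid E) B = 0%E.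
    apply/integral_counting_eq0 => M' mM' M'B; apply/eqP; rewrite eq_le measure_ge0 andbT.
    by rewrite -N0 le_measure ?inE// => y /M'B[[p q] [[_ /= Np] <-]].
  move/integral_counting_eq0; apply => // x Mx.
  by have [y Ny Exy] := MN _ Mx; exists (x, y).
(* By symmetry of E the statement is the same with sources and targets exchanged. *)
have null (s t : A -> X) B : measurable B -> measurable_fun B s ->
    (forall a, B a -> E (t a, s a)) ->
    (\int[mu]_x counting (B `&` s @^-1` [set x]) = 0)%E ->
    (\int[mu]_x counting (B `&` t @^-1` [set x]) = 0)%E.
  move=> mB ms BE /integral_counting_eq0 s0.
  have [|N [mN N0 sN]] := image_inner_null sX sA mB ms.
    by move=> M mM Ms; apply: s0 => // x /Ms[a Ba sa]; exists a.
  apply/integral_counting_eq0 => M mM Mt; apply: (sat N) => // x /Mt[a [Ba ta]].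
  by exists (s a); [apply: sN; exists a|rewrite -ta; exact: BE].
have GE' a : arr G a -> E (tgt G a, src G a) by move=> Ga; apply: GE; exists a.
move=> B mB BG; split; apply: null => //.
- exact: measurable_funS msrc.
- by move=> a /BG/GE'.
- exact: measurable_funS mtgt.
- by move=> a /BG/GE'; exact: eqrel_sym hE _ _.
Qed.

End Nonsingular.

(** * Constructions of standard Borel spaces *)

Lemma polish_of_balls (R : realType) (P : metricType R) :
  (forall F : set_system P, ProperFilter F ->
    (forall e, 0 < e -> exists p, F (ball p e)) ->
    exists p, forall e, 0 < e -> F (ball p e)) ->
  (exists2 D : set P, countable D &
    forall p e, 0 < e -> exists2 q, D q & mdist p q < e) ->
  polish P.
Proof.
move=> compl [D cD dD]; split=> [F PF /cauchyP cF|].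
  have [//|p Fp] := compl F PF; exists p.
  by apply/metricType_numDomainType.fcvgrPdist_lt => e /Fp; rewrite ballEmdist.
exists D => // O [p Op] oO; have /nbhs_ballP[e e0 eO] := open_nbhs_nbhs (conj oO Op).
by have [q Dq pq] := dD p e e0; exists q; split=> //; apply: eO; rewrite ballEmdist.
Qed.

(** By separability an open set is a countable union of balls, so that it is enough
to look at balls. *)
Lemma standard_borel_of_balls (R : realType) d (X : measurableType d) (P : metricType R)
    (f : X -> P) : polish P -> bijective f ->
  (forall p e, measurable (f @^-1` ball p e)) ->
  (forall B, measurable B -> exists2 W, <<s @open P >> W & f @^-1` W = B) ->
  standard_borel R X.
Proof.
move=> polP bijf mball mgen; exists P, f; split=> //; apply/seteqP; split=> [B /mgen[W sW <-]|].
  by exists W => //; rewrite setTI.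
move=> _ [W sW <-]; move: W sW; apply: smallest_sub => [|U oU]; first split.
- by rewrite preimage_set0 setI0; exact: measurable0.
- by move=> W; rewrite setTD !setTI; exact: measurableC.
- move=> F mF; rewrite setTI preimage_bigcup; apply: bigcupT_measurable => n.
  by have := mF n; rewrite setTI.
have [D denseD] := polish_dense_seq (f point) polP.
rewrite setTI (_ : f @^-1` U = \bigcup_(n in [set nk : nat * nat |
    ball (D nk.1) nk.2.+1%:R^-1 `<=` U]) (f @^-1` ball (D n.1) n.2.+1%:R^-1)).
  rewrite bigcup_mkcond; apply: countable_bigcupT_measurable => // n.
  by case: ifP => _; [exact: mball|exact: measurable0].
apply/seteqP; split=> [x Ux|x [n nU nx]]; last exact: nU.
have /nbhs_ballP[e /= e0 eU] := open_nbhs_nbhs (conj oU Ux : open_nbhs (f x) U).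
have [k /ltW ke] : exists k, k.+1%:R^-1 < e / 2 by apply: exists_invS_lt; rewrite divr_gt0.
have [n Dx] := denseD k.+1%:R^-1 (f x) ltac:(by rewrite invr_gt0 ltr0n).
exists (n, k) => /=; last by rewrite ballEmdist.
move=> q; rewrite ballEmdist /= => Dq; apply: eU; rewrite ballEmdist /= [ltRHS]splitr.
rewrite (le_lt_trans (metric_triangle _ (D n) _))// metric_sym.
by rewrite ltrD// (lt_le_trans _ ke).
Qed.

(** The set D serves for the i-th entry of a list, which is a continuous function
on the lists with more than i entries. *)
Lemma borel_preimage (R : realType) (P Q : metricType R) (h : P -> Q) (D : set P) :
  <<s @open P >> D -> (forall U, open U -> open (D `&` h @^-1` U)) ->
  forall W, <<s @open Q >> W -> <<s @open P >> (D `&` h @^-1` W).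
Proof.
move=> oD oh; have [s0 sC sU] := smallest_sigma_algebra setT (@open P).
apply: smallest_sub => [|U /oh]; last exact: sub_sigma_algebra.
split.
- by rewrite preimage_set0 setI0.
- move=> W sW; rewrite (_ : D `&` _ = ~` (~` D `|` (D `&` h @^-1` W))); last first.
    apply/seteqP; split=> [p [Dp [_ Wp]] [//|[_ /Wp]//]|p /not_orP[/contrapT Dp nW]].
    by split=> //; split=> // Wp; exact: nW.
  rewrite -setTD; apply: (sC); rewrite -bigcup2E; apply: (sU) => -[|[|n]] //=.
  by rewrite -setTD; exact: sC.
- by move=> F sF; rewrite preimage_bigcup setI_bigcupr; exact: sU.
Qed.

(** This copy of T and those of products and lists below carry metrics of their
own, apart from any other topology on these types. *)
Definition discrete_metric (T : Type) : Type := T.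

Section DiscreteMetric.
Context (R : realType) (T : choiceType).
Let D := discrete_metric T.
HB.instance Definition _ := Choice.on D.
Let dist (x y : D) : R := (x != y)%:R.
Let distxx x : dist x x = 0. Proof. by rewrite /dist eqxx. Qed.
Let dist_pos x y : dist x y = 0 -> x = y.
Proof. by rewrite /dist; case: eqVneq => // _ /eqP; rewrite oner_eq0. Qed.
Let dist_sym x y : dist x y = dist y x. Proof. by rewrite /dist eq_sym. Qed.
Let dist_tri y x z : dist x z <= dist x y + dist y z.
Proof.
rewrite /dist; case: (eqVneq x y) => [->|]; first by rewrite add0r.
by move=> _; apply: (@le_trans _ _ 1); rewrite ?lern1 ?leq_b1// lerDl ler0n.
Qed.
HB.instance Definition _ := isMetric.Build R D distxx dist_pos dist_sym dist_tri.
End DiscreteMetric.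

Lemma standard_borel_discrete (R : realType) d (T : measurableType d) :
  countable [set: T] -> (forall B : set T, measurable B) -> standard_borel R T.
Proof.
move=> cT mT; have ball1 (x y : discrete_metric T) : ball x (1 : R) y -> x = y.
  by rewrite ballEmdist /= /mdist /=; case: eqVneq => // _; rewrite ltxx.
apply: (@standard_borel_of_balls R d T (discrete_metric T) id) => //.
- apply: polish_of_balls => [F PF cF|].
    have [c Fc] := cF 1 ltr01; exists c => e e0; apply: filterS Fc => y /ball1 <-.
    exact: ballxx.
  by exists setT => // p e e0; exists p; rewrite // mdistxx.
- by exists id.
- move=> B _; exists B => //; apply: sub_sigma_algebra; rewrite openE => x Bx.
  by apply/nbhs_ballP; exists (1 : R) => [|y /ball1 <-]; first exact: ltr01.
Qed.

Definition prod_metric (P Q : Type) : Type := (P * Q)%type.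

Section ProdMetric.
Context (R : realType) (P Q : metricType R).
Let PQ := prod_metric P Q.
HB.instance Definition _ := Choice.copy PQ (P * Q)%type.
Let dist (x y : PQ) : R := Num.max (mdist x.1 y.1) (mdist x.2 y.2).
Let distxx x : dist x x = 0. Proof. by rewrite /dist !mdistxx maxxx. Qed.
Let dist_pos x y : dist x y = 0 -> x = y.
Proof.
case: x y => [x1 x2] [y1 y2] /eqP; rewrite eq_le ge_max /= => /andP[/andP[xy1 xy2] _].
by congr pair; apply: mdist_positivity; apply/eqP; rewrite eq_le mdist_ge0 andbT.
Qed.
Let dist_sym x y : dist x y = dist y x.
Proof. by rewrite /dist metric_sym (metric_sym x.2). Qed.
Let dist_tri y x z : dist x z <= dist x y + dist y z.
Proof.
rewrite {1}/dist ge_max; apply/andP; split.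
  by apply: le_trans (metric_triangle _ y.1 _) _; rewrite lerD// le_max lexx.
by apply: le_trans (metric_triangle _ y.2 _) _; rewrite lerD// le_max lexx orbT.
Qed.
HB.instance Definition _ := isMetric.Build R PQ distxx dist_pos dist_sym dist_tri.

Lemma ball_prod_metric (x : PQ) (e : R) :
  ball x e = [set y : PQ | ball x.1 e y.1 /\ ball x.2 e y.2].
Proof.
apply/seteqP; split=> y; rewrite !ballEmdist /= {1}/mdist /= gt_max => /andP//.
Qed.

Lemma polish_prod_metric : polish P -> polish Q -> polish PQ.
Proof.
move=> [cP [D1 cD1 dD1]] [cQ [D2 cD2 dD2]]; apply: polish_of_balls => [F PF cF|].
  have [p Fp] : exists p : P, fst @ F --> p.
    apply: cP; apply: cauchy_exP => e /cF[c Fc]; exists c.1.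
    suff : F [set y | ball c.1 e y.1] by [].
    by apply: filterS Fc => y; rewrite ball_prod_metric => -[].
  have [q Fq] : exists q : Q, snd @ F --> q.
    apply: cQ; apply: cauchy_exP => e /cF[c Fc]; exists c.2.
    suff : F [set y | ball c.2 e y.2] by [].
    by apply: filterS Fc => y; rewrite ball_prod_metric => -[].
  exists (p, q) => e e0; rewrite ball_prod_metric.
  by apply: filterI; [apply: Fp|apply: Fq]; apply/nbhs_ballP; exists e.
have dense (T : metricType R) (D : set T) : dense D -> forall p e, 0 < e ->
    exists2 q, D q & mdist p q < e.
  move=> dD p e e0; have [|q [pq Dq]] := dD (ball p e) _ (open_mball _ _).
    by exists p; exact: ballxx.
  by exists q => //; move: pq; rewrite ballEmdist.
exists (D1 `*` D2); first exact: countableX.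
move=> [p1 p2] e e0; have [q1 D1q1 pq1] := dense _ _ dD1 p1 e e0.
have [q2 D2q2 pq2] := dense _ _ dD2 p2 e e0.
by exists (q1, q2) => //; rewrite /mdist /= gt_max pq1.
Qed.

End ProdMetric.

Lemma standard_borel_prod (R : realType) d1 d2 (X : measurableType d1)
    (Y : measurableType d2) :
  standard_borel R X -> standard_borel R Y -> standard_borel R (X * Y)%type.
Proof.
move=> [P [f [polP [f' fK f'K] mX]]] [Q [g [polQ [g' gK g'K] mY]]].
pose h (z : X * Y) : prod_metric P Q := (f z.1, g z.2).
have mf (p : P) e : measurable (f @^-1` ball p e).
  rewrite mX; exists (ball p e); last by rewrite setTI.
  by apply: sub_sigma_algebra; exact: open_mball.
have mg (p : Q) e : measurable (g @^-1` ball p e).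
  rewrite mY; exists (ball p e); last by rewrite setTI.
  by apply: sub_sigma_algebra; exact: open_mball.
have open_fst (U : set P) : open U -> open (setT `&` [set z : prod_metric P Q | U z.1]).
  move=> oU; rewrite setTI openE => z Uz.
  have /nbhs_ballP[e e0 eU] := open_nbhs_nbhs (conj oU Uz); apply/nbhs_ballP.
  by exists e => // y; rewrite ball_prod_metric => -[/eU].
have open_snd (U : set Q) : open U -> open (setT `&` [set z : prod_metric P Q | U z.2]).
  move=> oU; rewrite setTI openE => z Uz.
  have /nbhs_ballP[e e0 eU] := open_nbhs_nbhs (conj oU Uz); apply/nbhs_ballP.
  by exists e => // y; rewrite ball_prod_metric => -[_ /eU].
have sT : <<s @open (prod_metric P Q) >> setT by apply: sub_sigma_algebra; exact: openT.
have [s0 sC sU] := smallest_sigma_algebra setT (@open (prod_metric P Q)).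
apply: (@standard_borel_of_balls R _ _ (prod_metric P Q) h).
- exact: polish_prod_metric.
- exists (fun z => (f' z.1, g' z.2)) => [[x y]|[x y]] /=; first by rewrite /h /= fK gK.
  by rewrite /h /= f'K g'K.
- move=> p e; rewrite ball_prod_metric.
  exact: (measurableX (mf p.1 e) (mg p.2 e)).
- apply: smallest_sub => [|B]; first split.
  + by exists set0.
  + move=> B [W sW WB]; exists (~` W); first by rewrite -setTD; exact: sC.
    by rewrite setTD -WB.
  + move=> F mF; have /choice[W HW] n : exists W,
        <<s @open (prod_metric P Q) >> W /\ h @^-1` W = F n.
      by have [W sW WF] := mF n; exists W.
    exists (\bigcup_n W n).
      by apply: (sU) => n; exact: (HW n).1.
    by rewrite preimage_bigcup; apply: eq_bigcup => // n _; exact: (HW n).2.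
  + move=> [] [C mC <-]; move: mC; rewrite ?mX ?mY => -[W sW <-].
      exists (setT `&` [set z : prod_metric P Q | W z.1]) => //.
        by move: W sW; exact: borel_preimage.
      by rewrite !setTI.
    exists (setT `&` [set z : prod_metric P Q | W z.2]) => //.
      by move: W sW; exact: borel_preimage.
    by rewrite !setTI.
Qed.

(** * The Borel structure on lists *)

Definition words (T : Type) : Type := seq T.

Section WordsMeasurable.
Context d (X : measurableType d).

HB.instance Definition _ := Choice.copy (words X) (seq X).
HB.instance Definition _ := isPointed.Build (words X) [::].

Definition entry_in i (B : set X) : set (words X) :=
  [set u | (i < size u)%N /\ B (nth point u i)].

Definition entry_sets : set (set (words X)) :=
  [set V | exists i B, measurable B /\ V = entry_in i B].

HB.instance Definition _ := @isMeasurable.Build (sigma_display entry_sets)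
  (words X) <<s entry_sets >> (@sigma_algebra0 _ setT entry_sets)
  (@sigma_algebraC _ entry_sets) (@sigma_algebra_bigcup _ setT entry_sets).

Lemma measurable_entry_in i B : measurable B -> measurable (entry_in i B).
Proof. by move=> mB; apply: sub_sigma_algebra; exists i, B. Qed.

Lemma measurable_size_gt i : measurable [set u : words X | (i < size u)%N].
Proof.
rewrite (_ : [set u | _] = entry_in i setT); first exact: measurable_entry_in.
by apply/seteqP; split=> [u|u []].
Qed.

Lemma measurable_size_eq n : measurable [set u : words X | size u = n].
Proof.
case: n => [|n].
  rewrite (_ : [set u | _] = ~` [set u : words X | (0 < size u)%N]).
    by apply: measurableC; exact: measurable_size_gt.
  by apply/seteqP; split=> u /=; rewrite lt0n; [move=> ->|move=> /negP/negPn/eqP].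
rewrite (_ : [set u | _] = [set u : words X | (n < size u)%N] `\`
    [set u : words X | (n.+1 < size u)%N]).
  by apply: measurableD; exact: measurable_size_gt.
apply/seteqP; split=> [u /= ->|u /= [nu /negP]]; first by split=> //; apply/negP; rewrite ltnn.
by rewrite -leqNgt => un; apply/eqP; rewrite eqn_leq un.
Qed.

Lemma measurable_nth i : measurable_fun setT (fun u : words X => nth point u i).
Proof.
move=> _ B mB; rewrite setTI.
have [Bp|Bp] := pselect (B point); last first.
  rewrite (_ : _ @^-1` B = entry_in i B); first exact: measurable_entry_in.
  apply/seteqP; split=> [u /= Bu|u []//]; split=> //.
  by rewrite ltnNge; apply/negP => iu; apply: Bp; rewrite nth_default in Bu.
rewrite (_ : _ @^-1` B = ~` entry_in i (~` B)).
  by apply: measurableC; apply: measurable_entry_in; exact: measurableC.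
apply/seteqP; split=> [u /= Bu [_]//|u /= nu]; apply: contrapT => nBu.
apply: nu; split=> //.
by rewrite ltnNge; apply/negP => iu; apply: nBu; rewrite nth_default.
Qed.

Lemma measurable_fun_words d' (Z : measurableType d') (h : Z -> words X) :
  (forall i B, measurable B -> measurable (h @^-1` entry_in i B)) ->
  measurable_fun setT h.
Proof.
move=> mh; apply: (@measurability _ _ _ _ setT h entry_sets) => // _ [_ [i [B [mB ->]]] <-].
by rewrite setTI; exact: mh.
Qed.

Lemma measurable_cons : measurable_fun setT (fun z : X * words X => z.1 :: z.2 : words X).
Proof.
apply: measurable_fun_words => -[|i] B mB.
  rewrite (_ : _ @^-1` _ = setT `&` fst @^-1` B); first exact: measurable_fst.
  by rewrite setTI; apply/seteqP; split=> [z []|z].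
rewrite (_ : _ @^-1` _ = setT `&` snd @^-1` entry_in i B) ?setTI//.
by rewrite -[X in measurable X]setTI; apply: measurable_snd => //; exact: measurable_entry_in.
Qed.

Lemma measurable_behead : measurable_fun setT (behead : words X -> words X).
Proof.
apply: measurable_fun_words => i B mB.
rewrite (_ : _ @^-1` _ = entry_in i.+1 B); first exact: measurable_entry_in.
by apply/seteqP; split=> -[|x u]; rewrite /entry_in /=; case.
Qed.

Lemma measurable_rev : measurable_fun setT (rev : words X -> words X).
Proof.
apply: measurable_fun_words => i B mB.
rewrite (_ : _ @^-1` _ = \bigcup_(n in [set n | (i < n)%N])
    ([set u : words X | size u = n] `&` [set u | B (nth point u (n - i.+1))])).
  apply: bigcup_measurable => n _; apply: measurableI; first exact: measurable_size_eq.
  by rewrite -[X in measurable X]setTI; exact: measurable_nth.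
apply/seteqP; split=> [u [/=]|u [n /= ilt [/= sizeu Bu]]].
  by rewrite size_rev => iu; rewrite nth_rev// => Bu; exists (size u).
by subst n; split; rewrite /= ?size_rev ?nth_rev.
Qed.

(** On the lists of a given length, the fold is a composition of finitely many
measurable maps. *)
Lemma measurable_foldr d' (Z : measurableType d') (f : X -> Z -> Z) :
  measurable_fun setT (fun p : X * Z => f p.1 p.2) ->
  measurable_fun setT (fun p : words X * Z => foldr f p.2 p.1).
Proof.
move=> mf; pose D n : set (words X * Z) := [set p | size p.1 = n].
have mD n : measurable (D n).
  rewrite /D -[X in measurable X]setTI.
  exact: (@measurable_fst _ _ (words X) Z measurableT _ (measurable_size_eq n)).
rewrite (_ : setT = \bigcup_n D n); last first.
  by apply/seteqP; split=> // p _; exists (size p.1).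
apply/measurable_fun_bigcup => // n.
pose F := fix F n (p : words X * Z) := if n is m.+1 then
  f (nth point p.1 0) (F m (behead p.1 : words X, p.2)) else p.2.
suff mF m : measurable_fun setT (F m).
  apply: (eq_measurable_fun (F n)) => [p|]; last exact: measurable_funTS.
  rewrite inE /D /=; case: p => u z /=.
  by elim: u n z {mF} => [|x u IH] [|m] z //= [um]; rewrite IH.
elim: m => [|m IH]; first exact: measurable_snd.
have m1 : measurable_fun setT (fun p : words X * Z => nth point p.1 0).
  exact: (measurableT_comp (measurable_nth 0) (@measurable_fst _ _ (words X) Z)).
have m2 : measurable_fun setT (fun p : words X * Z => (behead p.1 : words X, p.2)).
  apply: measurable_fun_pair; last exact: measurable_snd.
  exact: (measurableT_comp measurable_behead (@measurable_fst _ _ (words X) Z)).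
exact: (measurableT_comp mf (measurable_fun_pair m1 (measurableT_comp IH m2))).
Qed.

End WordsMeasurable.

Definition words_metric (P : Type) : Type := seq P.

Section WordsMetric.
Context (R : realType) (P : metricType R).
Let W := words_metric P.
HB.instance Definition _ := Choice.copy W (seq P).

(** Distances between entries are truncated at 1, the distance of two lists of
different lengths: lists at distance less than 1 have the same length, and
[ball_words_metric] describes small balls entry by entry. *)
Fixpoint words_dist (u v : seq P) : R :=
  match u, v with
  | [::], [::] => 0
  | x :: u, y :: v => Num.max (Num.min 1 (mdist x y)) (words_dist u v)
  | _, _ => 1
  end.

Lemma words_dist_ge0 u v : 0 <= words_dist u v.
Proof.
elim: u v => [|x u IH] [|y v] //=; rewrite ?ler01//.
by rewrite le_max IH orbT.
Qed.

Lemma words_dist_le1 u v : words_dist u v <= 1.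
Proof. by elim: u v => [|x u IH] [|y v] //=; rewrite ?ler01// ge_max ge_min lexx IH. Qed.

Let distxx u : words_dist u u = 0.
Proof. by elim: u => //= x u ->; rewrite mdistxx min_r ?ler01// maxxx. Qed.

Let dist_pos u v : words_dist u v = 0 -> u = v.
Proof.
elim: u v => [|x u IH] [|y v] //= /eqP; rewrite ?oner_eq0//.
rewrite eq_le ge_max => /andP[/andP[xy uv] _]; congr cons; last first.
  by apply: IH; apply/eqP; rewrite eq_le uv words_dist_ge0.
move: xy; rewrite ge_min leNgt ltr01 /= => xy.
by apply: mdist_positivity; apply/eqP; rewrite eq_le xy mdist_ge0.
Qed.

Let dist_sym u v : words_dist u v = words_dist v u.
Proof. by elim: u v => [|x u IH] [|y v] //=; rewrite metric_sym IH. Qed.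

Let dist_tri v u w : words_dist u w <= words_dist u v + words_dist v w.
Proof.
elim: u v w => [|x u IH] [|y v] [|z w] //=; rewrite ?addr0 ?add0r ?lerDl ?lerDr//.
- by rewrite le_max words_dist_ge0 orbT.
- by rewrite ge_max ge_min lerDl ler01 /= (le_trans (words_dist_le1 _ _))// lerDl ler01.
- by rewrite le_max words_dist_ge0 orbT.
rewrite ge_max; apply/andP; split; last first.
  by apply: le_trans (IH v w) _; rewrite lerD// le_max lexx orbT.
have [xy1|xy1] := leP 1 (mdist x y).
  rewrite ge_min; apply/orP; left; rewrite -[leLHS]addr0 lerD ?le_max ?lexx//.
  by rewrite le_min ler01 mdist_ge0.
have [yz1|yz1] := leP 1 (mdist y z).
  rewrite ge_min; apply/orP; left; rewrite -[leLHS]add0r lerD ?le_max ?lexx//.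
  by rewrite mdist_ge0.
rewrite ge_min; apply/orP; right; apply: (le_trans (metric_triangle _ y _)).
by rewrite lerD// le_max lexx.
Qed.

HB.instance Definition _ := isMetric.Build R W distxx dist_pos dist_sym dist_tri.

Lemma ball_words_metric (p0 : P) (u : W) (e : R) : 0 < e -> e <= 1 ->
  ball u e = [set v : W | size v = size u /\
    forall i, (i < size u)%N -> ball (nth p0 u i) e (nth p0 v i)].
Proof.
move=> e0 e1; rewrite ballEmdist; apply/seteqP; split=> v; rewrite /mdist /=.
  elim: u v => [|x u IH] [|y v] //=; rewrite ?ltNge ?e1// -ltNge gt_max gt_min ltNge e1 /=.
  move=> /andP[xy /IH[-> uv]]; split=> // -[|i]; first by rewrite ballEmdist.
  by rewrite ltnS; exact: uv.
elim: u v => [|x u IH] [|y v] [] //= [sz] xyuv.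
rewrite gt_max gt_min ltNge e1 /=; apply/andP; split.
  by have := xyuv 0%N isT; rewrite ballEmdist.
by apply: IH; split=> // i iu; exact: (xyuv i.+1).
Qed.

Lemma polish_words_metric : P -> polish P -> polish W.
Proof.
move=> p0 polP; have [D denseD] := polish_dense_seq p0 polP.
have [complP _] := polP; apply: polish_of_balls => [F PF cF|].
  have [c Fc] := cF 1 ltr01.
  have FS : F [set v : W | size v = size c].
    by apply: filterS Fc => v; rewrite (ball_words_metric p0)// => -[].
  have lim i : exists p : P, (i < size c)%N -> (fun v : W => nth p0 v i) @ F --> p.
    have [ic|//] := ltnP i (size c); last by exists p0.
    have [|p Fp] := complP ((fun v : W => nth p0 v i) @ F) _ _; last by exists p.
    apply: cauchy_exP => e e0.
    have m0 : 0 < Num.min e 1 by rewrite lt_min e0 ltr01.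
    have [u Fu] := cF _ m0; exists (nth p0 u i).
    suff : F [set v : W | ball (nth p0 u i) e (nth p0 v i)] by [].
    apply: filterS2 FS Fu => v sv; rewrite (ball_words_metric p0)//; last first.
      by rewrite ge_min lexx orbT.
    move=> [svu]; rewrite -svu [size v]sv => /(_ i ic); apply: le_ball.
    by rewrite ge_min lexx.
  have [p Fp] := choice lim; pose l : W := mkseq p (size c).
  exists l => e e0; pose e' := Num.min e 1.
  have e'0 : 0 < e' by rewrite lt_min e0 ltr01.
  have e'1 : e' <= 1 by rewrite ge_min lexx orbT.
  suff : F (ball l e') by apply: filterS; apply: le_ball; rewrite ge_min lexx.
  rewrite (ball_words_metric p0)// size_mkseq.
  suff Fn n : (n <= size c)%N -> F [set v : W | forall i, (i < n)%N ->
      ball (nth p0 l i) e' (nth p0 v i)].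
    by apply: filterS2 FS (Fn _ (leqnn _)) => v sv Hv; split.
  elim: n => [_|n IH nc]; first by apply: filterS filterT.
  have Fn : F [set v : W | ball (p n) e' (nth p0 v n)].
    by apply: (Fp n nc); apply/nbhs_ballP; exists e'.
  apply: filterS2 (IH (ltnW nc)) Fn => v Hv vn i; rewrite ltnS leq_eqVlt.
  by move=> /orP[/eqP->|/Hv//]; rewrite nth_mkseq.
exists (range (map D)) => [|u e e0].
  exact: sub_countable (card_image_le _ _) (countableP _).
have /choice[n Hn] p : exists n, mdist p (D n) < Num.min e 1.
  have [|n] := denseD (Num.min e 1) p; first by rewrite lt_min e0 ltr01.
  by rewrite metric_sym; exists n.
exists (map D (map n u)); first by exists (map n u).
rewrite {1}/mdist /=; elim: u => //= x u IH; rewrite gt_max IH andbT gt_min.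
by have := Hn x; rewrite lt_min => /andP[-> _]; rewrite orbT.
Qed.

End WordsMetric.

Lemma standard_borel_words (R : realType) d (X : measurableType d) :
  standard_borel R X -> standard_borel R (words X).
Proof.
move=> [P [f [polP [f' fK f'K] mX]]]; pose W : metricType R := words_metric P.
have mf (p : P) e : measurable (f @^-1` ball p e).
  rewrite mX; exists (ball p e); last by rewrite setTI.
  by apply: sub_sigma_algebra; exact: open_mball.
have [s0 sC sU] := smallest_sigma_algebra setT (@open W).
apply: (@standard_borel_of_balls R _ (words X) (words_metric P) (map f)).
- exact: polish_words_metric (f point) polP.
- by exists (map f'); [exact: mapK|exact: mapK].
- move=> u e; have [e0|e0] := leP e 0.
    rewrite (_ : _ @^-1` _ = set0)//; apply/seteqP; split=> // v.
    by rewrite /= ballEmdist /= => /lt_le_trans/(_ e0); rewrite ltNge mdist_ge0.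
  have [e1|e1] := ltP 1 e.
    rewrite (_ : _ @^-1` _ = setT); first exact: measurableT.
    apply/seteqP; split=> // v _; rewrite /= ballEmdist /=.
    exact: le_lt_trans (words_dist_le1 _ _) e1.
  rewrite (ball_words_metric (f point))// (_ : _ @^-1` _ =
    [set v : words X | size v = size u] `&` \bigcap_(i in [set i | (i < size u)%N])
      ((fun v : words X => nth point v i) @^-1` (f @^-1` ball (nth (f point) u i) e))).
    apply: measurableI; first exact: measurable_size_eq.
    apply: bigcap_measurableType => i _; rewrite -[X in measurable X]setTI.
    exact: measurable_nth.
  apply/seteqP; split=> v /=; rewrite size_map => -[sv Hv]; split=> // i /= iu.
    by have := Hv i iu; rewrite (nth_map point)// sv.
  by rewrite (nth_map point) ?sv//; exact: Hv.
- apply: smallest_sub => [|_ [i [B [mB ->]]]]; first split.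
  + by exists set0.
  + move=> B [V sV VB]; exists (~` V); first by rewrite -setTD; exact: sC.
    by rewrite setTD -VB.
  + move=> F mF; have /choice[V HV] n : exists V,
        <<s @open W >> V /\ map f @^-1` V = F n by have [V] := mF n; exists V.
    exists (\bigcup_n V n); first by apply: (sU) => n; exact: (HV n).1.
    by rewrite preimage_bigcup; apply: eq_bigcup => // n _; exact: (HV n).2.
  + move: mB; rewrite mX => -[V sV]; rewrite setTI => <-.
    pose D : set W := [set u | (i < size u)%N].
    have oD (U : set P) : open U -> open (D `&` (fun u : W => nth (f point) u i) @^-1` U).
      move=> oU; rewrite openE => u [iu Uu]; apply/nbhs_ballP.
      have /nbhs_ballP[e e0 eU] := open_nbhs_nbhs (conj oU Uu).
      pose e' := Num.min e 1; exists e'; first by rewrite /= lt_min e0 ltr01.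
      move=> v; rewrite (ball_words_metric (f point)) ?lt_min ?e0 ?ltr01//; last first.
        by rewrite ge_min lexx orbT.
      move=> [sv Hv]; split; first by rewrite /D /= sv.
      by apply: eU; apply: le_ball (Hv _ iu); rewrite ge_min lexx.
    exists (D `&` (fun u : W => nth (f point) u i) @^-1` V).
      apply: borel_preimage sV => //; apply: sub_sigma_algebra.
      by have := oD setT openT; rewrite preimage_setT setIT.
    by apply/seteqP; split=> u; rewrite /D /= size_map => -[iu];
      rewrite /= (nth_map point).
Qed.

(** * Free products of groups of order two *)

Section Involutions.
Variable L : eqType.
Implicit Types (z : L) (u v w : seq L).

(** Reduced words are the normal forms of the elements of the free product of
groups of order two indexed by L. *)
Definition reduced u := sorted [rel x y | x != y] u.

(** The product of a generator and a reduced word. *)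
Definition push z u :=
  if u is y :: v then if y == z then v else z :: u else [:: z].

Definition wmul u v := foldr push v u.

Lemma reduced_push z u : reduced u -> reduced (push z u).
Proof.
case: u => //= y u; case: eqVneq => [->|yz ru]; first exact: path_sorted.
by rewrite /reduced /= eq_sym yz.
Qed.

Lemma reduced_wmul u v : reduced v -> reduced (wmul u v).
Proof. by move=> rv; elim: u => //= z u; exact: reduced_push. Qed.

Lemma reduced_rev u : reduced u -> reduced (rev u).
Proof.
rewrite /reduced rev_sorted; congr is_true; apply: eq_sorted => x y /=.
by rewrite eq_sym.
Qed.

Lemma pushK z u : reduced u -> push z (push z u) = u.
Proof.
case: u => [|y u] /=; first by rewrite eqxx.
case: eqVneq => [->|yz] /=; last by rewrite eqxx.
by case: u => //= x u /andP[/negPf + _]; rewrite eq_sym => ->.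
Qed.

(** On reduced words every generator acts as an involution ([pushK]); this is where
the relations of the free product enter the proof of associativity. *)
Lemma wmul_push z u v : reduced v -> wmul (push z u) v = push z (wmul u v).
Proof.
move=> rv; case: u => //= y u; case: eqVneq => [->|//].
by rewrite pushK// reduced_wmul.
Qed.

Lemma wmulA u v w : reduced w -> wmul u (wmul v w) = wmul (wmul u v) w.
Proof. by move=> rw; elim: u => //= z u ->; rewrite wmul_push. Qed.

Lemma wmul1 u : reduced u -> wmul u [::] = u.
Proof.
elim: u => //= z u IH ru; rewrite IH; last exact: path_sorted ru.
by case: u ru {IH} => //= y u /andP[]; rewrite eq_sym => /negPf->.
Qed.

Lemma wmul_revl u : wmul (rev u) u = [::].
Proof.
elim: u => // z u IH; rewrite rev_cons -cats1 /wmul foldr_cat /= eqxx.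
exact: IH.
Qed.

Lemma wmul_revr u : wmul u (rev u) = [::].
Proof. by rewrite -{1}[u]revK wmul_revl. Qed.

Lemma push_subset z u : {subset push z u <= z :: u}.
Proof.
case: u => //= y u; case: eqVneq => _ x xu //.
by rewrite !inE xu !orbT.
Qed.

Lemma wmul_subset u v : {subset wmul u v <= u ++ v}.
Proof.
elim: u => //= z u IH x /push_subset; rewrite !inE => /orP[->//|/IH->].
by rewrite orbT.
Qed.

Section Action.
Variables (W : zmodType) (act : L -> W -> W).
Hypothesis actD : forall z, {morph act z : p q / p + q}.
Hypothesis actK : forall z, involutive (act z).

Definition acts u (p : W) := foldr act p u.

Lemma acts_push z u p : acts (push z u) p = act z (acts u p).
Proof. by case: u => //= y u; case: eqVneq => //= ->; rewrite actK. Qed.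

Lemma acts_wmul u v p : acts (wmul u v) p = acts u (acts v p).
Proof. by elim: u => //= z u <-; rewrite acts_push. Qed.

Lemma actsD u : {morph acts u : p q / p + q}.
Proof. by move=> p q; elim: u => //= z u ->; exact: actD. Qed.

Lemma acts0 u : acts u 0 = 0.
Proof. by apply: (addrI (acts u 0)); rewrite -actsD !addr0. Qed.

Lemma actsN u p : acts u (- p) = - acts u p.
Proof. by apply/eqP; rewrite -addr_eq0 -actsD addNr acts0 eqxx. Qed.

End Action.
End Involutions.

(** * The action on integer polynomials *)

(** For b = false the pairs 2j, 2j+1 are exchanged; for b = true the pairs 2j+1,
2j+2 are exchanged and 0 is fixed. Together the two involutions act
transitively. *)
Definition flip (b : bool) i := if odd i (+) b then i.-1 else i.+1.

Lemma flipK b : involutive (flip b).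
Proof.
move=> i; rewrite {2}/flip; case: ifP => [|ib]; last by rewrite /flip /= addNb ib.
case: i => [|i] /=; first by case: b.
by rewrite /flip addNb => /negbTE->.
Qed.

Section Letters.
Variables (X : Type) (c : X -> nat -> bool).

(** The signs carry the code of the point, while the permutations do not depend
on the point and serve to reach every monomial from the constant 1. As [flip]
moves an index by at most one, the bound (size p).+1 loses no coefficient. *)
Definition letter_act (l : X * nat) (p : {poly int}) : {poly int} :=
  if l.2 is k.+1 then \poly_(i < (size p).+1) p`_(flip (odd k) i)
  else \poly_(i < size p) (if c l.1 i then - p`_i else p`_i).

Lemma coef_letter_act l p i : (letter_act l p)`_i =
  if l.2 is k.+1 then p`_(flip (odd k) i)
  else if c l.1 i then - p`_i else p`_i.
Proof.
rewrite /letter_act; case: l.2 => [|k]; rewrite coef_poly; case: ltnP => // ip.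
  by rewrite nth_default// oppr0 if_same.
rewrite nth_default// /flip; case: ifP => _; last by rewrite ltnW// ltnW.
by rewrite -ltnS (leq_trans ip)// leqSpred.
Qed.

Lemma letter_actD l : {morph letter_act l : p q / p + q}.
Proof.
move=> p q; apply/polyP => i; rewrite coefD !coef_letter_act.
by case: l.2 => [|k]; rewrite coefD//; case: ifP => //; rewrite opprD.
Qed.

Lemma letter_actK l : involutive (letter_act l).
Proof.
move=> p; apply/polyP => i; rewrite coef_letter_act.
case E: l.2 => [|k]; rewrite coef_letter_act E ?flipK//.
by case: (c l.1 i); rewrite ?opprK.
Qed.

Lemma letter_act_shift x n : letter_act (x, (odd n).+1) 'X^n = 'X^(n.+1).
Proof.
apply/polyP => i; rewrite coef_letter_act /= !coefXn oddb; congr (_%:R).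
have fn : flip (odd n) n = n.+1 by rewrite /flip addbb.
by congr nat_of_bool; rewrite -fn -[in RHS](flipK (odd n) i) (can_eq (flipK (odd n))).
Qed.

Lemma letter_act_sign x n : letter_act (x, 0%N) 'X^n = if c x n then - 'X^n else 'X^n.
Proof.
apply/polyP => i; rewrite coef_letter_act /= coefXn.
have [->|/negPf ni] := eqVneq i n.
  by case: ifP => _; rewrite ?coefN coefXn eqxx.
by rewrite oppr0 if_same; case: ifP => _; rewrite ?coefN coefXn ni ?oppr0.
Qed.

End Letters.

(** * The twisted groupoid *)

(** A copy of the polynomials that carries the discrete sigma-algebra. *)
Definition coeffs : Type := {poly int}.

HB.instance Definition _ := Countable.copy coeffs {poly int}.
HB.instance Definition _ := isPointed.Build coeffs (0 : {poly int}).
HB.instance Definition _ := @isMeasurable.Build default_measure_display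
  coeffs (@discrete_measurable coeffs) (@discrete_measurable0 coeffs)
  (@discrete_measurableC coeffs) (@discrete_measurableU coeffs).

Lemma measurable_fun_coeffs d1 d2 (Z : measurableType d1) (T : measurableType d2)
    (f : Z -> coeffs -> T) :
  (forall k, measurable_fun setT (f ^~ k)) ->
  measurable_fun setT (fun p : Z * coeffs => f p.1 p.2).
Proof.
move=> mf _ Y mY; rewrite setTI.
rewrite (_ : _ @^-1` Y = \bigcup_k ((f ^~ k) @^-1` Y `*` [set k])).
  apply: countable_bigcupT_measurable => // k; apply: measurableX => //.
  by rewrite -[X in measurable X]setTI; exact: mf.
apply/seteqP; split=> [[z k] /= Yk|[z k] [k' _ [/= Yk ->]]//].
by exists k.
Qed.

Section TwistedGroupoid.
Context (R : realType) d (X : measurableType d) (mu : probability X R).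
Variables (E : set (X * X)) (c : X -> nat -> bool).
Hypothesis sX : standard_borel R X.
Hypothesis hE : countable_measured_eqrel mu E.
Hypothesis mc : forall n, measurable_fun setT (c ^~ n).
Local Notation L := (X * nat)%type.
Local Notation A := ((X * X) * (coeffs * words (X * nat)))%type.

(** The second component of an arrow is an element of the semidirect product of
the polynomials by the free product over the letters (z, k), with z in the class
of the target. This group depends on the class only, so that arrows compose by
the multiplication of the group. *)
Definition twisted_groupoid : groupoid_ops X A := {|
  arr := [set a | [/\ E a.1, reduced (a.2.2 : seq L) &
    forall l, l \in (a.2.2 : seq L) -> E (a.1.1, l.1)]];
  src := fun a => a.1.2;
  tgt := fun a => a.1.1;
  Defs.unit_of := fun x => ((x, x), (0 : {poly int}, [::]));
  Defs.mul := fun a b => ((a.1.1, b.1.2),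
    ((a.2.1 : {poly int}) + acts (letter_act c) a.2.2 b.2.1, wmul a.2.2 b.2.2));
  Defs.inv := fun a => ((a.1.2, a.1.1),
    (- acts (letter_act c) (rev (a.2.2 : seq L)) a.2.1, rev (a.2.2 : seq L))) |}.
Local Notation G := twisted_groupoid.

Let actD := letter_actD c.
Let actK := letter_actK c.

Lemma twisted_is_groupoid : is_groupoid G.
Proof.
have Er := eqrel_refl hE; have Es := eqrel_sym hE; have Et := eqrel_trans hE.
split=> /=.
- by move=> x; split=> //=; exact: Er.
- by [].
- by [].
- move=> [[x y] [w u]] [[y' z] [w' u']] [/= [Exy ru Eu] [Eyz ru' Eu'] yy'].
  rewrite yy' in Exy Eu *; split=> /=; [exact: Et Eyz|exact: reduced_wmul|].
  move=> l /wmul_subset; rewrite mem_cat => /orP[/Eu//|/Eu'].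
  by apply: Et.
- by [].
- by [].
- move=> [[x y] [w u]] [[y' z] [w' u']] [[z' t] [w'' u'']] [_ _ _] [_ [_ /= ru'' _] _].
  by rewrite acts_wmul// actsD// addrA wmulA.
- by move=> [[x y] [w u]] _ /=; rewrite add0r.
- by move=> [[x y] [w u]] [_ /= ru _]; rewrite acts0// addr0 wmul1.
- move=> [[x y] [w u]] [/= Exy ru Eu]; split=> /=; [exact: Es|exact: reduced_rev|].
  by move=> l; rewrite mem_rev => /Eu; apply: Et; exact: Es.
- by [].
- by [].
- by move=> [[x y] [w u]] _ /=; rewrite addNr wmul_revl.
- by move=> [[x y] [w u]] _ /=; rewrite actsN// -acts_wmul// wmul_revr subrr.
Qed.

Lemma assoc_rel_twisted : assoc_rel G = E.
Proof.
apply/seteqP; split=> [_ [[[x y] [w u]] [Exy _ _] <-]//|[x y] Exy].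
by exists ((x, y), (0 : {poly int}, [::])).
Qed.

Lemma standard_borel_letters : standard_borel R L.
Proof.
apply: standard_borel_prod => //.
by apply: standard_borel_discrete => //; exact: countableP.
Qed.

Lemma standard_borel_arrows : standard_borel R A.
Proof.
apply: standard_borel_prod; first exact: standard_borel_prod.
apply: standard_borel_prod; last exact: (standard_borel_words standard_borel_letters).
by apply: standard_borel_discrete => //; exact: countableP.
Qed.

Lemma measurable_letter_act :
  measurable_fun setT (fun p : L * coeffs => letter_act c p.1 p.2 : coeffs).
Proof.
apply: (@measurable_fun_coeffs _ _ L coeffs (letter_act c)) => p _ Y _; rewrite setTI.
rewrite (_ : _ @^-1` Y = \bigcup_(q in Y) [set l : L | letter_act c l p = q]).
  rewrite bigcup_mkcond; apply: countable_bigcupT_measurable; first exact: countableP.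
  move=> q.
  case: ifP => // _.
  rewrite (_ : [set l | _] = \bigcap_i \bigcup_k (
      [set x | (letter_act c (x, k) p)`_i = q`_i] `*` [set k])).
    apply: bigcapT_measurable => i; apply: bigcupT_measurable => k.
    apply: measurableX => //.
    rewrite (_ : [set x | _] = setT `&` (c ^~ i) @^-1` [set b | (if k is k'.+1
        then p`_(flip (odd k') i) else if b then - p`_i else p`_i) = q`_i]).
      exact: mc.
    by rewrite setTI; apply/seteqP; split=> x /=; rewrite coef_letter_act.
  apply/seteqP; split=> [[x k] /= <- i _|[x k] Hq]; first by exists k.
  by apply/polyP => i; have [k' _ [/= + ->]] := Hq i Logic.I.
by apply/seteqP; split=> [l Yl|l [q Yq /= ->]//]; exists (letter_act c l p).
Qed.

Lemma measurable_acts :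
  measurable_fun setT (fun p : words L * coeffs => acts (letter_act c) p.1 p.2 : coeffs).
Proof. exact: measurable_foldr measurable_letter_act. Qed.

Lemma measurable_push :
  measurable_fun setT (fun p : L * words L => push p.1 p.2 : words L).
Proof.
pose hd (p : L * words L) := (0 < size p.2)%N && (nth point p.2 0 == p.1).
have m2 : measurable_fun setT (fun p : L * words L => p.2) by exact: measurable_snd.
rewrite (_ : (fun p => _) = (fun p : L * words L =>
    if hd p then behead p.2 : words L else p.1 :: p.2)); last first.
  by apply/funext => -[z [|y u]].
apply: measurable_fun_ifT.
- apply: (@measurable_fun_bool _ _ _ _ true).
  have mD : measurable [set p : L * words L | (0 < size p.2)%N].
    by rewrite -[X in measurable X]setTI; exact: (m2 measurableT _ (measurable_size_gt 0)).
  have := measurable_coincidence standard_borel_letters mD 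
    (f := fun p : L * words L => nth point p.2 0) (g := fun p : L * words L => p.1).
  rewrite (_ : _ `&` _ = setT `&` hd @^-1` [set true]) ?setTI.
    apply; last exact: measurable_funTS measurable_fst.
    by apply: measurable_funTS; exact: measurableT_comp (measurable_nth 0) m2.
  apply/seteqP; split=> p; rewrite /hd /=; first by move=> [-> ->]; rewrite eqxx.
  by move=> /andP[-> /eqP].
- exact: measurableT_comp (@measurable_behead _ _) m2.
- exact: measurable_cons.
Qed.

Lemma measurable_wmul :
  measurable_fun setT (fun p : words L * words L => wmul p.1 p.2 : words L).
Proof. exact: measurable_foldr measurable_push. Qed.

Lemma measurable_arr : measurable (arr G).
Proof.
have mE := eqrel_measurable hE.
have m1 : measurable_fun setT (fun a : A => a.1) by exact: measurable_fst.
have m22 : measurable_fun setT (fun a : A => a.2.2).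
  exact: measurableT_comp (@measurable_snd _ _ _ _) (@measurable_snd _ _ _ _).
have mnth i : measurable_fun setT (fun a : A => nth point a.2.2 i).
  exact: measurableT_comp (measurable_nth i) m22.
have msz i : measurable [set a : A | (i < size a.2.2)%N].
  by rewrite -[X in measurable X]setTI; exact: (m22 measurableT _ (measurable_size_gt i)).
rewrite (_ : arr G = [set a : A | E a.1] `&`
  (\bigcap_i ~` ([set a : A | (i.+1 < size a.2.2)%N] `&`
     [set a : A | nth point a.2.2 i = nth point a.2.2 i.+1]) `&`
   \bigcap_i ~` ([set a : A | (i < size a.2.2)%N] `&`
     (fun a : A => (a.1.1, (nth point a.2.2 i).1)) @^-1` ~` E))).
  apply: measurableI; first by rewrite -[X in measurable X]setTI; exact: m1.
  apply: measurableI; apply: bigcapT_measurable => i; apply: measurableC.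
    apply: (measurable_coincidence standard_borel_letters) => //; exact: measurable_funTS.
  apply: measurableI => //; rewrite -[X in measurable X]setTI.
  apply: measurable_fun_pair => //; last exact: measurableC.
    exact: measurableT_comp (@measurable_fst _ _ _ _) m1.
  exact: measurableT_comp (@measurable_fst _ _ _ _) (mnth i).
apply/seteqP; split=> [a [Ea /(sortedP point) ra Ca]|a [Ea [ra Ca]]].
  split=> //; split=> i _ /= [ia]; first by move=> aa; have := ra _ ia; rewrite /= aa eqxx.
  by apply; apply: Ca; exact: mem_nth.
split=> //; first by apply/(sortedP point) => i ia; apply/eqP => aa; apply: (ra i).
move=> l la; apply: contrapT => nE; apply: (Ca (index l (a.2.2 : seq L))) => //.
by split; rewrite /= ?index_mem ?nth_index.
Qed.

(** An enumeration of C turns the arrows with all their points in C into elements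
of a countable type. *)
Lemma countable_fiber (C : set X) (S : set A) : countable C ->
  (forall a, S a -> [/\ C a.1.1, C a.1.2 & forall l, l \in (a.2.2 : seq L) -> C l.1]) ->
  countable S.
Proof.
move=> cC SC; have [->//|/set0P[a0 Sa0]] := eqVneq S set0.
have [e einj] := countable_injP _ cC.
have /choice[g Hg] n : exists x, forall y, C y -> e y = n -> x = y.
  have [[y [Cy yn]]|ny] := pselect (exists y, C y /\ e y = n).
    by exists y => z Cz zn; apply: einj; rewrite ?inE// yn zn.
  by exists point => y Cy yn; exfalso; apply: ny; exists y.
have gK y : C y -> g (e y) = y by move=> Cy; exact: Hg.
pose enc (a : A) : nat * nat * ({poly int} * seq (nat * nat)) :=
  ((e a.1.1, e a.1.2), (a.2.1, map (fun l => (e l.1, l.2)) (a.2.2 : seq L))).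
apply/countable_injP; exists (pickle \o enc) => a b; rewrite !inE => Sa Sb.
move=> /(pcan_inj (@pickleK _)).
case: a b Sa Sb => [[x y] [w u]] [[x' y'] [w' u']].
move=> /SC[/= Cx Cy Cu] /SC[/= Cx' Cy' Cu'] [ex ey -> eu].
rewrite -(gK x)// -(gK y)// ex ey !gK//; congr (_, (_, _)).
have uK v : (forall l, l \in v -> C l.1) ->
    map (fun l : nat * nat => (g l.1, l.2)) (map (fun l : L => (e l.1, l.2)) v) = v.
  by move=> Cv; rewrite -map_comp map_id_in// => -[z k] /Cv /= Cz; rewrite gK.
by rewrite -(uK u Cu) eu uK.
Qed.

Lemma twisted_discrete_borel : discrete_borel_groupoid R G.
Proof.
have Es := eqrel_sym hE; have Et := eqrel_trans hE.
have m11 : measurable_fun setT (fun a : A => a.1.1).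
  exact: measurableT_comp (@measurable_fst _ _ _ _) (@measurable_fst _ _ _ _).
have m12 : measurable_fun setT (fun a : A => a.1.2).
  exact: measurableT_comp (@measurable_snd _ _ _ _) (@measurable_fst _ _ _ _).
have m21 : measurable_fun setT (fun a : A => a.2.1).
  exact: measurableT_comp (@measurable_fst _ _ _ _) (@measurable_snd _ _ _ _).
have m22 : measurable_fun setT (fun a : A => a.2.2).
  exact: measurableT_comp (@measurable_snd _ _ _ _) (@measurable_snd _ _ _ _).
have mcoeff d1 (Z : measurableType d1) (f g : Z -> coeffs) (op : coeffs -> coeffs -> coeffs) :
    measurable_fun setT f -> measurable_fun setT g ->
    measurable_fun setT (fun z => op (f z) (g z)).
  move=> mf mg; have mop : measurable_fun setT (fun p : coeffs * coeffs => op p.1 p.2).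
    by apply: measurable_fun_coeffs => k.
  exact: measurableT_comp mop (measurable_fun_pair mf mg).
split.
- exact: twisted_is_groupoid.
- exact: sX.
- exact: standard_borel_arrows.
- exact: measurable_arr.
- rewrite (_ : range _ = [set p : X * X | p.1 = p.2] `*`
      ([set (0 : {poly int})] `*` [set u : words L | size u = 0%N])).
    apply: measurableX; last by apply: measurableX => //; exact: measurable_size_eq.
    rewrite -[X in measurable X]setTI; apply: (measurable_coincidence sX) => //.
  apply/seteqP; split=> [_ [x _ <-]//|[[x y] [w u]] /= [-> [-> /size0nil ->]]].
  by exists y.
- by apply: measurable_fun_pair; [exact: measurable_fun_pair|exact: measurable_cst].
- exact: measurable_funTS.
- exact: measurable_funTS.
- apply: measurable_funTS; apply: measurable_fun_pair.
    apply: measurable_fun_pair.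
      exact: measurableT_comp m11 (@measurable_fst _ _ _ _).
    exact: measurableT_comp m12 (@measurable_snd _ _ _ _).
  have f22 := measurableT_comp m22 (@measurable_fst _ _ A A).
  apply: measurable_fun_pair; last first.
    exact: (measurableT_comp measurable_wmul
      (measurable_fun_pair f22 (measurableT_comp m22 (@measurable_snd _ _ A A)))).
  have f21 := measurableT_comp m21 (@measurable_fst _ _ A A).
  have s21 := measurableT_comp m21 (@measurable_snd _ _ A A).
  exact: (mcoeff _ _ _ _ (fun p q => (p : {poly int}) + q) f21
    (measurableT_comp measurable_acts (measurable_fun_pair f22 s21))).
- apply: measurable_funTS; apply: measurable_fun_pair.
    exact: measurable_fun_pair.
  have mr := measurableT_comp (@measurable_rev _ L) m22.
  apply: measurable_fun_pair => //.
  have ma := measurableT_comp measurable_acts (measurable_fun_pair mr m21).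
  exact: (mcoeff _ _ _ _ (fun p _ => - (p : {poly int})) ma ma).
- move=> x; apply: (countable_fiber (eqrel_countable hE x)).
  move=> [[y z] [w u]] [[/= Eyx _ Eu] /= xx]; subst z.
  split=> /=; [exact: Es|exact: eqrel_refl hE _|move=> l /Eu; exact/Et/Es].
- move=> x; apply: (countable_fiber (eqrel_countable hE x)).
  move=> [[y z] [w u]] [[/= Eyx _ Eu] /= xx]; subst y.
  by split=> //=; exact: eqrel_refl hE _.
Qed.

Lemma twisted_measured : discrete_measured_groupoid mu G.
Proof.
split; first exact: twisted_discrete_borel.
have dG := twisted_discrete_borel.
apply: (assoc_rel_nonsingular sX standard_borel_arrows _ _ _ hE).
- exact: dbg_arr dG.
- exact: dbg_src dG.
- exact: dbg_tgt dG.
- by rewrite assoc_rel_twisted.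
Qed.

End TwistedGroupoid.

(** * Genuineness over a diffuse measure *)

Lemma countable_null (R : realType) d (X : measurableType d) (mu : {measure set X -> \bar R})
    (C : set X) : countable C -> measurable C ->
  (forall x, C x -> measurable [set x] /\ mu [set x] = 0%E) -> mu C = 0%E.
Proof.
move=> cC mC C0; have [e einj] := countable_injP _ cC.
apply: (measure_negligible mC).
rewrite (_ : C = \bigcup_n [set x | C x /\ e x = n]); last first.
  by apply/seteqP; split=> [x Cx|x [n _ []//]]; exists (e x).
apply: negligible_bigcup => n.
have [[x [Cx xn]]|nx] := pselect (exists x, C x /\ e x = n).
  exists [set x]; have [mx x0] := C0 x Cx; split=> // y [Cy yn] /=.
  by apply: einj; rewrite ?inE// yn xn.
rewrite (_ : [set x | _] = set0); first exact: negligible_set0.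
by apply/seteqP; split=> // x Hx; apply: nx; exists x.
Qed.

Lemma conull_neq0 (R : realType) d (X : measurableType d) (mu : probability X R) (X0 : set X) :
  conull mu X0 -> mu X0 <> 0%E.
Proof.
move=> [mX0 nX0] X00; have := @probability_setC _ _ _ mu _ mX0.
by rewrite nX0 X00 sube0 => /eqP; rewrite eq_sym onee_eq0.
Qed.

Section Genuine.
Context (R : realType) d (X : measurableType d) (mu : probability X R).
Variables (E : set (X * X)) (c : X -> nat -> bool).
Hypothesis sX : standard_borel R X.
Hypothesis hE : countable_measured_eqrel mu E.
Hypothesis c_inj : injective c.
Local Notation G := (twisted_groupoid E c).
Local Notation A := ((X * X) * (coeffs * words (X * nat)))%type.

Definition isotropy (x : X) (w : {poly int}) (u : seq (X * nat)) : A := ((x, x), (w, u)).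

Lemma restr_isotropy (X0 : set X) x w (u : seq (X * nat)) : X0 x ->
  reduced u -> (forall l, l \in u -> l.1 = x) -> restr_arr G X0 (isotropy x w u).
Proof.
move=> X0x ru ux; split=> //; split=> //; split=> //=.
  exact: eqrel_refl hE x.
by move=> l /ux ->; exact: eqrel_refl hE x.
Qed.

(** In a relation the unit is the only arrow from a point to itself, but the
constant polynomials 0 and 1 give two such arrows. *)
Lemma twisted_not_eqrel : ~ isomorphic_to_eqrel mu G.
Proof.
move=> [dY [Y [nu [S [_ _ [X0 [Y0 [f [[cX0 _] [_ finj _] _ [fM _] _]]]]]]]]].
have [x X0x] : X0 !=set0.
  by apply/set0P/eqP => X00; apply: (conull_neq0 cX0); rewrite X00 measure0.
have rg : restr_arr G X0 (isotropy x 1 [::]) by exact: restr_isotropy.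
have r0 : restr_arr G X0 (isotropy x 0 [::]) by exact: restr_isotropy.
have isoc g h : restr_arr G X0 g -> restr_arr G X0 h -> src G g = tgt G h ->
    (f g).2 = (f h).1.
  by move=> rg' rh gh; have [] := fM g h rg' rh; [split; [case: rg' => -[]|case: rh => -[]|]|case].
have /(finj _ _) : f (isotropy x 1 [::]) = f (isotropy x 0 [::]).
  have := isoc _ _ rg rg erefl; have := isoc _ _ rg r0 erefl.
  have := isoc _ _ r0 r0 erefl; case: (f _) => ? ?; case: (f _) => ? ? /=.
  by move=> -> -> ->.
rewrite !inE => /(_ rg r0)[/eqP]; by rewrite oner_eq0.
Qed.

Lemma isotropy_conj x n :
  Defs.mul G (Defs.mul G (isotropy x 0 [:: (x, (odd n).+1)]) (isotropy x 'X^n [::]))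
    (isotropy x 0 [:: (x, (odd n).+1)]) = isotropy x 'X^(n.+1) [::].
Proof.
have l0 : letter_act c (x, (odd n).+1) 0 = 0.
  exact: (@acts0 _ _ (letter_act c) (letter_actD c) [:: (x, (odd n).+1)]).
by rewrite /= /isotropy eqxx add0r letter_act_shift l0 addr0.
Qed.

Lemma isotropy_comm x n :
  Defs.mul G (isotropy x 0 [:: (x, 0%N)]) (isotropy x 'X^n [::]) =
  Defs.mul G (isotropy x 'X^n [::]) (isotropy x 0 [:: (x, 0%N)]) <-> c x n = false.
Proof.
rewrite /= /isotropy /= addr0 add0r letter_act_sign; case: (c x n); split=> //.
move=> [/eqP]; rewrite -subr_eq0 -opprD oppr_eq0 -mulr2n => /eqP/polyP/(_ n)/eqP.
by rewrite coefMn coefXn eqxx coef0.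
Qed.

Fixpoint conj_iter (T : groupType) (a b0 b1 : T) n : T :=
  if n is m.+1 then
    let b := if odd m then b1 else b0 in (b * conj_iter a b0 b1 m * b)%g
  else a.

(** For the elements 1 of Z[t], (x, 0), (x, 1) and (x, 2) of the group of a class,
this sequence is c x. *)
Definition commutation_code (T : groupType) (p : T * T * (T * T)) n : bool :=
  let g := conj_iter p.1.1 p.2.1 p.2.2 n in (p.1.2 * g != g * p.1.2)%g.

(** An isomorphism onto a transformation groupoid of T restricts to embeddings of
the isotropy groups in T, which preserve [commutation_code]. It hence attaches to
x a quadruple of T that determines x, and conull sets would be countable. *)
Lemma twisted_not_transformation : diffuse mu -> ~ isomorphic_to_transformation mu G.
Proof.
move=> dmu [dY [Y [nu [T [a [_ cT _ [X0 [Y0 [f [[cX0 _] [_ finj _] _ [fM _] _]]]]]]]]]].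
have isoM x g h : X0 x -> restr_arr G X0 g -> restr_arr G X0 h ->
    src G g = x -> tgt G g = x -> src G h = x -> tgt G h = x ->
    (f g).1 = (f h).1 /\
    f (Defs.mul G g h) = ((f h).1, ((f g).2 : T) * (f h).2)%g.
  move=> X0x rg rh sg tg sh th.
  have cc g' h' : restr_arr G X0 g' -> restr_arr G X0 h' -> src G g' = tgt G h' ->
      composable G (g', h') by move=> [[? _] _] [[? _] _].
  have [[_ _ /= gh] ->] := fM g h rg rh (cc _ _ rg rh (etrans sg (esym th))).
  have [[_ _ /= hh] _] := fM h h rh rh (cc _ _ rh rh (etrans sh (esym th))).
  by split=> //; rewrite gh -hh.
pose phi x w u : T := (f (isotropy x w u)).2.
have phiM x w u w' u' : X0 x ->
    reduced u -> (forall l, l \in u -> l.1 = x) ->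
    reduced u' -> (forall l, l \in u' -> l.1 = x) ->
    (f (Defs.mul G (isotropy x w u) (isotropy x w' u'))).2 = (phi x w u * phi x w' u')%g :> T.
  move=> X0x ru ux ru' ux'.
  have [] := isoM x (isotropy x w u) (isotropy x w' u') X0x _ _ erefl erefl erefl erefl.
  - exact: restr_isotropy.
  - exact: restr_isotropy.
  - by move=> _ ->.
have nil1 (x : X) : forall l : X * nat, l \in [::] -> l.1 = x by [].
have seq1 (x : X) k : forall l : X * nat, l \in [:: (x, k)] -> l.1 = x.
  by move=> l; rewrite inE => /eqP->.
pose kappa x := ((phi x 'X^0 [::], phi x 0 [:: (x, 0%N)]),
  (phi x 0 [:: (x, 1%N)], phi x 0 [:: (x, 2%N)])).
have iterE x n : X0 x -> phi x 'X^n [::] =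
    conj_iter (kappa x).1.1 (kappa x).2.1 (kappa x).2.2 n.
  move=> X0x; elim: n => // n IH; rewrite /= -IH /phi -(isotropy_conj x n).
  pose l := (x, (odd n).+1).
  have mulE : Defs.mul G (isotropy x 0 [:: l]) (isotropy x 'X^n [::]) =
      isotropy x (letter_act c l 'X^n) [:: l] by rewrite /= add0r.
  have lmul : phi x (letter_act c l 'X^n) [:: l] = (phi x 0%R [:: l] * phi x 'X^n [::])%g.
    by rewrite -phiM// ?mulE//; exact: seq1.
  rewrite mulE phiM//; [|exact: seq1|exact: seq1].
  rewrite lmul.
  by rewrite /l; case: (odd n).
have codeE x : X0 x -> c x = commutation_code (kappa x).
  move=> X0x; apply/funext => n.
  have zM := phiM x 0 [:: (x, 0%N)] 'X^n [::] X0x isT (@seq1 _ _) isT (@nil1 _).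
  have Mz := phiM x 'X^n [::] 0 [:: (x, 0%N)] X0x isT (@nil1 _) isT (@seq1 _ _).
  rewrite (_ : commutation_code _ n =
    ((phi x 0%R [:: (x, 0%N)] * phi x 'X^n [::])%g !=
     (phi x 'X^n [::] * phi x 0%R [:: (x, 0%N)])%g)); last first.
    by rewrite /commutation_code -iterE.
  rewrite -zM -Mz; case cxn: (c x n); last first.
    by have /isotropy_comm -> := cxn; rewrite eqxx.
  apply/esym/eqP => eqf.
  suff : c x n = false by rewrite cxn.
  apply/isotropy_comm; apply: finj; rewrite ?inE.
  - rewrite /= add0r; exact: restr_isotropy (seq1 _ _).
  - rewrite /= addr0; exact: restr_isotropy (seq1 _ _).
  have rz := restr_isotropy (u := [:: (x, 0%N)]) 0 X0x isT (@seq1 _ _).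
  have ra := restr_isotropy (u := [::]) 'X^n X0x isT (@nil1 _).
  have [za1 zaM] := isoM x _ _ X0x rz ra erefl erefl erefl erefl.
  have [_ azM] := isoM x _ _ X0x ra rz erefl erefl erefl erefl.
  rewrite zaM azM za1; congr pair; have := eqf.
  by rewrite zaM azM.
apply: (conull_neq0 cX0); apply: countable_null (cX0.1) _ => [|x _]; last first.
  by split; [exact: standard_borel_set1 sX|exact: dmu].
have cT4 : countable [set: T * T * (T * T)].
  have cT2 : countable [set: T * T] by rewrite -setXTT; exact: countableX.
  by rewrite -setXTT; exact: countableX.
have [e einj] := countable_injP _ cT4.
apply/countable_injP; exists (e \o kappa) => x y; rewrite !inE => X0x X0y.
move=> /einj; rewrite !inE => /(_ Logic.I Logic.I) kxy.
by apply: c_inj; rewrite (codeE x)// (codeE y)// kxy.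
Qed.

End Genuine.

(** * Transitive groupoids over a set of atoms *)

Definition additive_group (V : zmodType) : Type := V.
HB.instance Definition _ (V : zmodType) := Choice.copy (additive_group V) V.
HB.instance Definition _ (V : zmodType) := @isGroup.Build (additive_group V)
  (0 : V) (@GRing.opp V) (@GRing.add V) (@addrA V) (@add0r V) (@addr0 V) (@addNr V) (@addrN V).

(** Cyclic groups for the finite sets; for the infinite ones any countable infinite
group will do, here the rational numbers. *)
Lemma countable_bij_group (T : Type) (S : set T) : countable S -> S !=set0 ->
  exists (K : groupType) (e : T -> K), countable [set: K] /\ set_bij S setT e.
Proof.
move=> cS [s Ss]; have [fS|iS] := pselect (finite_set S); last first.
  have /card_set_bijP[e bije] : (S #= [set: rat])%card.
    by apply: card_eq_trans (eq_card_nat cS iS) _; rewrite card_eq_sym card_rat.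
  by exists (additive_group rat), e; split; first exact: (@countableP rat).
have [n /card_set_bijP[f [fI finj fsurj]]] := (finite_setP _).1 fS.
case: n => [|n] in fI fsurj; first by have := fI s Ss.
exists 'I_n.+1, (inord \o f); split; first exact: countableP.
split=> // [x y Sx Sy /(congr1 val)|i _] /=.
  rewrite !inordK; [exact: finj|exact: (fI _ (set_mem Sy))|exact: (fI _ (set_mem Sx))].
have [x Sx fx] := fsurj i (ltn_ord i).
by exists x => //=; rewrite fx inord_val.
Qed.

Section VertexGroup.
Context (X : Type) (A : choiceType) (G : groupoid_ops X A).
Implicit Types (g h k : A) (x y z t : X).

Definition hom x y g := [/\ arr G g, src G g = x & tgt G g = y].

Hypothesis hG : is_groupoid G.

Lemma homM x y z g h : hom y z g -> hom x y h -> hom x z (Defs.mul G g h).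
Proof.
move=> [ag sg tg] [ah sh th]; have c : composable G (g, h) by split=> //=; rewrite sg.
by split; [exact: arr_mul|rewrite src_mul|rewrite tgt_mul].
Qed.

Lemma homV x y g : hom x y g -> hom y x (Defs.inv G g).
Proof.
by move=> [ag <- <-]; split; [exact: arr_inv|exact: src_inv|exact: tgt_inv].
Qed.

Lemma hom1 x : hom x x (unit_of G x).
Proof. by split; [exact: arr_unit|exact: src_unit|exact: tgt_unit]. Qed.

Lemma homA x y z t g h k : hom z t g -> hom y z h -> hom x y k ->
  Defs.mul G g (Defs.mul G h k) = Defs.mul G (Defs.mul G g h) k.
Proof.
by move=> [ag sg _] [ah sh th] [ak _ tk]; apply: mul_assoc => //; split=> //=;
  rewrite ?sg ?sh.
Qed.

Lemma hom1M x y g : hom x y g -> Defs.mul G (unit_of G y) g = g.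
Proof. by move=> [ag _ <-]; exact: mul_unitl. Qed.

Lemma homM1 x y g : hom x y g -> Defs.mul G g (unit_of G x) = g.
Proof. by move=> [ag <- _]; exact: mul_unitr. Qed.

Lemma homVM x y g : hom x y g -> Defs.mul G (Defs.inv G g) g = unit_of G x.
Proof. by move=> [ag <- _]; exact: mul_invl. Qed.

Lemma homMV x y g : hom x y g -> Defs.mul G g (Defs.inv G g) = unit_of G y.
Proof. by move=> [ag _ <-]; exact: mul_invr. Qed.

Lemma homKV x y z g h : hom y z g -> hom x z h ->
  Defs.mul G g (Defs.mul G (Defs.inv G g) h) = h.
Proof. by move=> hg hh; rewrite (homA hg (homV hg) hh) (homMV hg) (hom1M hh). Qed.

Lemma homVK x y z g h : hom y z g -> hom x y h ->
  Defs.mul G (Defs.inv G g) (Defs.mul G g h) = h.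
Proof. by move=> hg hh; rewrite (homA (homV hg) hg hh) (homVM hg) (hom1M hh). Qed.

Lemma homMKV x y z g h : hom x z g -> hom x y h ->
  Defs.mul G (Defs.mul G g (Defs.inv G h)) h = g.
Proof. by move=> hg hh; rewrite -(homA hg (homV hh) hh) (homVM hh) (homM1 hg). Qed.

Lemma homMVK x y z g h : hom y z g -> hom x y h ->
  Defs.mul G (Defs.mul G g h) (Defs.inv G h) = g.
Proof. by move=> hg hh; rewrite -(homA hg hh (homV hh)) (homMV hh) (homM1 hg). Qed.

(** The isotropy group at x. The type mentions the proof that G is a groupoid
because its group structure depends on it. *)
Definition vertex_group (_ : is_groupoid G) x : Type := {g : A | `[< hom x x g >]}.

Variable x : X.
Local Notation V := (vertex_group hG x).

HB.instance Definition _ := Choice.copy V {g : A | `[< hom x x g >]}.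

Lemma vertex_homP (k : V) : hom x x (val k).
Proof. exact/asboolP/(valP k). Qed.

Definition vertex g (hg : hom x x g) : V := exist _ g (asboolT hg).

Let one : V := vertex (hom1 x).
Let mul (k l : V) : V := vertex (homM (vertex_homP k) (vertex_homP l)).
Let inv (k : V) : V := vertex (homV (vertex_homP k)).
Let mulA : associative mul.
Proof.
by move=> k l m; apply: val_inj; exact: homA (vertex_homP _) (vertex_homP _) (vertex_homP _).
Qed.
Let mul1l : left_id one mul.
Proof. by move=> k; apply: val_inj; exact: hom1M (vertex_homP _). Qed.
Let mull1 : right_id one mul.
Proof. by move=> k; apply: val_inj; exact: homM1 (vertex_homP _). Qed.
Let mulVl : left_inverse one inv mul.
Proof. by move=> k; apply: val_inj; exact: homVM (vertex_homP _). Qed.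
Let mullV : right_inverse one inv mul.
Proof. by move=> k; apply: val_inj; exact: homMV (vertex_homP _). Qed.

HB.instance Definition _ := isGroup.Build V mulA mul1l mull1 mulVl mullV.

Lemma val_vertexM (k l : V) : val (k * l)%g = Defs.mul G (val k) (val l).
Proof. by []. Qed.

End VertexGroup.

Section Transitive.
Context (R : realType) d d' (X : measurableType d) (A : measurableType d').
Context (mu : probability X R) (G : groupoid_ops X A) (S : set X).
Hypothesis dG : discrete_borel_groupoid R G.
Hypothesis cS : countable S.
Hypothesis conullS : conull mu S.
Hypothesis atomS : forall x, S x -> mu [set x] <> 0%E.
Hypothesis transS : forall x y, S x -> S y -> assoc_rel G (x, y).

Let sX : standard_borel R X := dbg_unit_space dG.
Let sA : standard_borel R A := dbg_ambient dG.
Let hG : is_groupoid G := dbg_groupoid dG.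

Lemma null_atoms (C : set X) : measurable C -> mu C = 0%E <-> forall x, S x -> ~ C x.
Proof.
move=> mC; split=> [C0 x Sx Cx|CS].
  apply: (atomS Sx); apply/eqP; rewrite eq_le measure_ge0 andbT -C0 le_measure ?inE//.
    exact: standard_borel_set1 sX.
  by move=> _ ->.
apply/eqP; rewrite eq_le measure_ge0 andbT -conullS.2 le_measure ?inE//.
  exact: measurableC conullS.1.
by move=> x Cx Sx; exact: CS Sx Cx.
Qed.

Lemma src_null_atoms (B : choiceType) (s : B -> X) (C : set B) :
  (forall b, C b -> S (s b)) ->
  (\int[mu]_x counting (C `&` s @^-1` [set x]) = 0)%E <-> C = set0.
Proof.
move=> CS; split=> [/integral_counting_eq0 C0|->]; last first.
  apply/integral_counting_eq0 => M mM MC; apply/null_atoms => // x _ /MC[b []//].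
apply/seteqP; split=> // b Cb; apply: (atomS (CS b Cb)); apply: C0.
  exact: standard_borel_set1 sX.
by move=> _ ->; exists b.
Qed.

Lemma countable_restr_arr : countable (restr_arr G S).
Proof.
apply: (@sub_countable _ _ _ (\bigcup_(x in S) (arr G `&` src G @^-1` [set x]))).
  by apply: subset_card_le => g [[ag Ss] _]; exists (src G g).
by apply: bigcup_countable => // x _; exact: dbg_src_countable dG x.
Qed.

(** Arrows [tau y] from a base point x0 to the points y of S identify G over S with
the product of S x S and the isotropy group K at x0, and a bijection [e] of S with
a group L turns S x S into the transformation groupoid of the translations of L.
The action is extended by the identity to the null complement of S, in order to
have a standard Borel space to act on. *)
Lemma transitive_transformation : isomorphic_to_transformation mu G.
Proof.
have [x0 Sx0] : S !=set0.
  by apply/set0P/eqP => S0; apply: (conull_neq0 conullS); rewrite S0 measure0.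
have [L [e [cL [_ einj esurj]]]] := countable_bij_group cS (ex_intro _ x0 Sx0).
have {esurj} /choice[e' He'] l : exists x, S x /\ e x = l.
  by have [x Sx ex] := esurj l Logic.I; exists x.
have Se' l : S (e' l) by exact: (He' l).1.
have e'K l : e (e' l) = l by exact: (He' l).2.
have eK x : S x -> e' (e x) = x by move=> Sx; apply: einj; rewrite ?inE// e'K.
have /choice[tau Htau] y : exists g, S y -> hom G x0 y g.
  have [Sy|nSy] := pselect (S y); last by exists point.
  by have [g ag [tg sg]] := transS Sy Sx0; exists g.
pose K : groupType := vertex_group hG x0.
pose Gam : groupType := (K * L)%type.
pose a (p : Gam) y := if `[< S y >] then e' (p.2 * e y)%g else y.
have aS p y : S y -> a p y = e' (p.2 * e y)%g by move=> Sy; rewrite /a asboolT.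
have anS p y : ~ S y -> a p y = y by move=> Sy; rewrite /a asboolF.
have aSS p y : S y -> S (a p y) by move=> Sy; rewrite aS.
have aSSn p y : S (a p y) -> S y.
  by have [//|nSy] := pselect (S y); rewrite anS.
have hom_restr g : restr_arr G S g ->
    [/\ hom G (src G g) (tgt G g) g, S (src G g) & S (tgt G g)].
  by move=> [[ag Ss] St]; split.
pose conj g := Defs.mul G (Defs.mul G (Defs.inv G (tau (tgt G g))) g) (tau (src G g)).
have homconj g : restr_arr G S g -> hom G x0 x0 (conj g).
  move=> /hom_restr[hg Ss St].
  exact: (homM hG (homM hG (homV hG (Htau _ St)) hg) (Htau _ Ss)).
pose k0 : K := 1%g.
pose f g : X * discrete_group Gam :=
  (src G g, ((insubd k0 (conj g) : K, (e (tgt G g) * (e (src G g))^-1)%g) : Gam)).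
have valf g : restr_arr G S g -> val ((f g).2 : Gam).1 = conj g.
  by move=> rg; rewrite /f /= insubdK//; exact/asboolT/homconj.
have tgtf g : restr_arr G S g -> a (f g).2 (src G g) = tgt G g.
  by move=> /hom_restr[hg Ss St]; rewrite aS//= mulgVK eK.
have countable_Gam : countable [set: Gam].
  rewrite -setXTT; apply: countableX => //.
  have [i iinj] := countable_injP _ (dbg_src_countable dG x0).
  apply/countable_injP; exists (i \o val) => k l _ _ /= kl; apply: val_inj.
  by apply: iinj kl; rewrite inE; have [] := vertex_homP k; have [] := vertex_homP l.
have mem_mul g h : restr_arr G S g -> restr_arr G S h -> src G g = tgt G h ->
    restr_arr G S (Defs.mul G g h).
  move=> rg rh gh; have [hg Ssg Stg] := hom_restr _ rg; have [hh Ssh Sth] := hom_restr _ rh.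
  rewrite gh in hg; have [am sm tm] := homM hG hg hh.
  by split; [split|] => //=; rewrite ?sm ?tm.
have fM g h : restr_arr G S g -> restr_arr G S h -> src G g = tgt G h ->
    f (Defs.mul G g h) = (src G h, (((f g).2 : Gam) * ((f h).2 : Gam))%g).
  move=> rg rh gh; have [hg Ssg Stg] := hom_restr _ rg; have [hh Ssh Sth] := hom_restr _ rh.
  have rm := mem_mul _ _ rg rh gh.
  have hg' := hg; rewrite gh in hg'; have [am sm tm] := homM hG hg' hh.
  rewrite {1}/f sm tm; congr (_, (_, _)); last by rewrite /= gh mulgA mulgVK.
  apply: val_inj; rewrite val_vertexM !valf//.
  rewrite /conj sm tm gh.
  have ht := homV hG (Htau _ Stg); have hs := Htau _ Sth.
  have hs' := Htau _ Ssh.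
  rewrite -(homA hG (homM hG ht hg') hs (homM hG (homM hG (homV hG hs) hh) hs')).
  rewrite -(homA hG (homV hG hs) hh hs').
  rewrite (homKV hG hs (homM hG hh hs')).
  rewrite (homA hG (homM hG ht hg') hh hs').
  by rewrite (homA hG ht hg' hh).
(* Units are idempotent, and the only idempotent of a group is 1. *)
have f1 x : S x -> ((f (unit_of G x)).2 : Gam) = 1%g.
  move=> Sx; have [au su tu] := hom1 hG x.
  have ru : restr_arr G S (unit_of G x) by split; [split|] => //=; rewrite ?su ?tu.
  have := fM _ _ ru ru (etrans su (esym tu)); rewrite (hom1M hG (hom1 hG x)) => /(congr1 snd) /= ff.
  by apply: (mulgI ((f (unit_of G x)).2 : Gam)); rewrite -[LHS]ff mulg1.
have apre p B : measurable B -> measurable (a p @^-1` B).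
  move=> mB; rewrite (_ : _ @^-1` B = (B `&` ~` S) `|` (S `&` a p @^-1` B)); last first.
    apply/seteqP; split=> y /=.
      have [Sy|nSy] := pselect (S y); [by right|left].
      by split=> //; rewrite -(anS p y).
    by move=> [[By nSy]|[]//]; rewrite /= anS.
  apply: measurableU; first by apply: measurableI => //; exact: measurableC conullS.1.
  apply: (standard_borel_countable sX); apply: sub_countable cS.
  by apply: subset_card_le => y [].
exists d, X, mu, Gam, a; split=> //.
  split.
  - by move=> y; have [Sy|nSy] := pselect (S y); [rewrite aS//= mul1g eK|rewrite anS].
  - move=> p q y; have [Sy|nSy] := pselect (S y); last by rewrite !anS.
    by rewrite (aS q)// !aS//= e'K mulgA.
  - by move=> p _ B mB; rewrite setTI; exact: apre.
  - move=> p B mB; rewrite (null_atoms (apre p B mB)) (null_atoms mB).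
    split=> [nB x Sx Bx|nB x Sx]; last by apply: nB; exact: aSS.
    apply: (nB (e' (p.2^-1 * e x)%g)) => //=.
    by rewrite aS// e'K mulVKg eK.
exists S, S, f; split.
- by split.
- split.
  + move=> g rg; have [hg Ssg Stg] := hom_restr _ rg; split; [split|] => //=.
    by rewrite (tgtf g rg).
  + move=> g h /set_mem rg /set_mem rh fgh.
    have [hg Ssg Stg] := hom_restr _ rg; have [hh Ssh Sth] := hom_restr _ rh.
    have ss : src G g = src G h := congr1 fst fgh.
    have tt : tgt G g = tgt G h by rewrite -tgtf// -tgtf// fgh ss.
    have := valf g rg; rewrite fgh valf// /conj ss tt => cgh.
    rewrite ss tt in hg; have ht := Htau _ Sth; have hs := Htau _ Ssh.
    have := congr1 (fun k => Defs.mul G k (Defs.inv G (tau (src G h)))) cgh.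
    rewrite !(homMVK hG (homM hG (homV hG ht) _) hs)//.
    move=> /(congr1 (Defs.mul G (tau (tgt G h)))).
    by rewrite (homKV hG ht hh) (homKV hG ht hg).
  + move=> [y [k l]] [[_ /= Sy] /= St].
    pose z := e' (l * e y)%g; have Sz : S z by exact: Se'.
    have hk : hom G x0 x0 (val k) by exact: vertex_homP.
    have hky := homM hG hk (homV hG (Htau _ Sy)).
    have [ag sg tg] := homM hG (Htau _ Sz) hky.
    set g := Defs.mul G (tau z) _ in ag sg tg.
    have rg : restr_arr G S g by split; [split|] => //=; rewrite ?sg ?tg.
    exists g => //; rewrite /f sg tg e'K mulgK; congr (_, (_, _)).
    apply: val_inj; rewrite insubdK; last exact/asboolT/homconj.
    by rewrite /conj sg tg /g (homVK hG (Htau _ Sz) hky) (homMKV hG hk (Htau _ Sy)).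
- have mcount (C : set A) : C `<=` restr_arr G S -> countable C.
    by move=> CS; apply: sub_countable countable_restr_arr; exact: subset_card_le.
  split=> [_ Y mY|C mC CS].
    by apply: (standard_borel_countable sA); apply: mcount => g [].
  apply: countable_measurable => [[y p]|].
    rewrite (_ : [set _] = [set y] `*` [set p]); last first.
      by apply/seteqP; split=> [_ ->|[? ?] [/= -> ->]].
    by apply: measurableX => //; exact: standard_borel_set1 sX.
  exact: sub_countable (card_image_le _ _) (mcount C CS).
- split=> [g h rg rh [_ _ /= gh]|g rg].
    split; last by rewrite fM.
    by split=> //=; rewrite (tgtf h rh).
  have [hg Ss St] := hom_restr _ rg; have [ai si ti] := homV hG hg.
  have ri : restr_arr G S (Defs.inv G g) by split; [split|] => //=; rewrite ?si ?ti.
  have := fM _ _ ri rg si; rewrite (homVM hG hg) => fVg.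
  have fi : (((f (Defs.inv G g)).2 : Gam)^-1)%g = ((f g).2 : Gam).
    by apply: mulg1_eq; rewrite -(f1 _ Ss); exact: esym (congr1 snd fVg).
  rewrite [LHS]surjective_pairing; congr pair; first by rewrite /= (tgtf g rg) si.
  exact: (etrans (esym (invgK _)) (congr1 (fun z : Gam => z^-1)%g fi)).
- move=> C mC CS; rewrite /mu_src.
  rewrite (src_null_atoms (s := src G)) => [|g /CS[[]]//].
  rewrite (src_null_atoms (s := fst)) => [|_ [g /CS[[_ Ss] _] <-]//].
  by split=> [->|/image_set0_set0//]; rewrite image_set0.
Qed.

End Transitive.

(** * Diffuse measures and genuine groupoids *)

Lemma diffuse_genuine (R : realType) d (X : measurableType d) (mu : probability X R)
    (E : set (X * X)) : standard_borel R X -> countable_measured_eqrel mu E ->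
  ergodic_rel mu E -> diffuse mu ->
  exists c, genuine mu (twisted_groupoid E c) /\ assoc_rel (twisted_groupoid E c) = E.
Proof.
move=> sX hE hErg dmu; have [U [mU Usep]] := standard_borel_separated sX.
pose c x n := `[< U n x >]; exists c; split; last exact: assoc_rel_twisted.
have c_inj : injective c.
  move=> x y cxy; apply: Usep => n /asboolP Un; apply/asboolP.
  by have := congr1 (@^~ n) cxy; rewrite /c => <-.
have mc n : measurable_fun setT (c ^~ n).
  apply: (@measurable_fun_bool _ _ _ _ true); rewrite setTI.
  rewrite (_ : _ @^-1` _ = U n)//; apply/seteqP; split=> x; first by move/asboolP.
  by move=> Un; apply/asboolP.
split; first exact: twisted_measured.
- by rewrite /ergodic_groupoid assoc_rel_twisted.
- exact: twisted_not_eqrel hE.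
- exact: twisted_not_transformation.
Qed.

(** The class C of an atom is an invariant set of positive measure, hence conull,
and its null points are countably many. *)
Lemma atom_transformation (R : realType) d (X : measurableType d) (mu : probability X R)
    (E : set (X * X)) d' (A : measurableType d') (G : groupoid_ops X A) x :
  countable_measured_eqrel mu E -> ergodic_rel mu E -> mu [set x] <> 0%E ->
  discrete_borel_groupoid R G -> eq_rel_ae mu (assoc_rel G) E ->
  isomorphic_to_transformation mu G.
Proof.
move=> hE hErg mux dG [X0 [mX0 cX0] GE]; have sX := dbg_unit_space dG.
pose C := [set y | E (x, y)]; have cC : countable C by exact: eqrel_countable hE x.
have m1 y : measurable [set y : X] by exact: standard_borel_set1 sX.
have Cx : C x by exact: eqrel_refl hE x.
have mC : measurable C by exact: standard_borel_countable sX cC.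
pose N := C `&` [set y | mu [set y] = 0%E]; pose S := (C `&` X0) `\` N.
have subC B : B `<=` C -> countable B by move=> BC; exact: sub_countable (subset_card_le BC) cC.
have mN : measurable N by apply: (standard_borel_countable sX); apply: subC => y [].
have N0 : mu N = 0%E by apply: countable_null => //; [apply: subC => y []|move=> y []].
have nC : mu (~` C) = 0%E.
  have [|C0|//] := hErg C mC.
    move=> y z Eyz; split=> Cy; first exact: eqrel_trans hE _ _ _ Cy Eyz.
    exact: eqrel_trans hE _ _ _ Cy (eqrel_sym hE Eyz).
  exfalso; apply: mux; apply/eqP; rewrite eq_le measure_ge0 andbT -C0 le_measure ?inE//.
  by move=> _ ->.
apply: (@transitive_transformation _ _ _ _ _ _ _ S dG).
- by apply: subC => y [[]].
- have mS : measurable S by apply: measurableD => //; exact: measurableI.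
  split=> //; apply: measure_negligible; first exact: measurableC.
  apply: (@negligibleS _ _ _ _ ((~` C `|` ~` X0) `|` N)).
    move=> y nSy; have [Ny|nNy] := pselect (N y); [by right|left].
    by rewrite -setCI => -[Cy X0y]; apply: nSy.
  apply: negligibleU; [apply: negligibleU|].
  - by exists (~` C); split=> //; exact: measurableC.
  - by exists (~` X0); split=> //; exact: measurableC.
  - by exists N; split.
- by move=> y [[Cy _] nNy] y0; apply: nNy.
- move=> y z [[Cy X0y] _] [[Cz X0z] _]; apply/GE => //.
  exact: eqrel_trans hE _ _ _ (eqrel_sym hE Cy) Cz.
Qed.

Theorem theorem2 (R : realType) (d : measure_display) (X : measurableType d)
    (mu : probability X R) (E : set (X * X))
    (hX : standard_borel R X)
    (hE : countable_measured_eqrel mu E)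
    (hErg : ergodic_rel mu E) :
  diffuse mu <->
  (exists (d' : measure_display) (A : measurableType d')
     (G : groupoid_ops X A),
     genuine mu G /\ eq_rel_ae mu (assoc_rel G) E).
Proof.
split=> [dmu|[d' [A [G [[[dG _] _ _ nG] GE]]]] x].
  have [c [gG GE]] := diffuse_genuine hX hE hErg dmu.
  exists _, _, (twisted_groupoid E c); split=> //; rewrite GE.
  exists setT => //; split; first exact: measurableT.
  by rewrite setCT measure0.
by apply: contrapT => mux; apply: nG; exact: atom_transformation mux dG GE.
Qed.
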